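(* Let $H$ be a Hilbert space and let $M\subset B(H)$ be a von Neumann subalgebra. Assume that $M$ is isomorphic, as a von Neumann algebra, to the von Neumann tensor product $M\otimes M$ (actually, it suffices to assume that $M\otimes M$ embeds into $M$ as a contractively complemented subalgebra). If $M$ is complemented in $B(H)$, then $M$ is contractively complemented in $B(H)$.
   Context: For a Hilbert space $H$, $B(H)$ is the algebra of bounded linear operators on $H$. A closed subspace $S$ of a Banach space $B$ is called complemented in $B$ if there is a bounded linear projection $P:B\to B$ with range $S$ (no assumption on the norm of $P$), and contractively complemented if there is such a projection with $\|P\|\le 1$. For a von Neumann algebra $M\subset B(H)$, $M\otimes M$ denotes the von Neumann tensor product, i.e. the weak*-closure of the algebraic tensor product of $M$ with itself in $B(H\otimes H)$, where $H\otimes H$ is the Hilbert space tensor product. ''$M\otimes M$ embeds into $M$ as a contractively complemented subalgebra'' means that there is an injective $*$-homomorphism $M\otimes M\to M$ whose range is contractively complemented in $M$. *)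

(* Defs.v *)
From HB Require Import structures.
From mathcomp Require Import all_boot all_order all_algebra.
From mathcomp Require Import sesquilinear complex.
From mathcomp Require Import all_classical all_reals all_analysis.

Set Implicit Arguments.
Unset Strict Implicit.
Unset Printing Implicit Defensive.

Import Order.TTheory GRing.Theory Num.Theory.
Import numFieldNormedType.Exports.

Local Open Scope classical_set_scope.
Local Open Scope ring_scope.
Local Open Scope complex_scope.

(* Complex Hilbert spaces. The norm of a normed module over R[i] takes its
   values in R[i] (in fact in the nonnegative reals). As for all forms of
   sesquilinear.v, the inner product is linear on the left and conjugate-linear
   on the right. *)
HB.mixin Record hasInnerProduct (R : realType) H
    of CompleteNormedModule R[i] H := {
  inner : {dot H for @Num.conj R[i]} ;
  sqr_norm_inner : forall x : H, `|x| ^+ 2 = inner x x }.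

#[short(type="hilbertType")]
HB.structure Definition Hilbert (R : realType) :=
  {H of CompleteNormedModule R[i] H & hasInnerProduct R H}.

Section BoundedOperators.
Context {R : realType} {H : hilbertType R}.
Implicit Types T S : H -> H.

Definition bounded_operator : {pred H -> H} := fun T =>
  `[< linear T /\ exists C : R[i], forall x, `|T x| <= C * `|x| >].

Lemma bounded_operatorP T : reflect
  (linear T /\ exists C : R[i], forall x, `|T x| <= C * `|x|)
  (T \in bounded_operator).
Proof. exact: asboolP. Qed.

Lemma bounded_operator_submod : submod_closed bounded_operator.
Proof.
split.
  apply/bounded_operatorP; split.
    by move=> a x y; rewrite [LHS]/GRing.zero /= scaler0 addr0.
  by exists 0 => x; rewrite mul0r normr0.
move=> a S T /bounded_operatorP[lS [C hC]] /bounded_operatorP[lT [D hD]].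
apply/bounded_operatorP; split.
  move=> b x y; rewrite !fctE lS lT !scalerDr !scalerA (mulrC a b).
  by rewrite -!addrA; congr (_ + _); rewrite addrCA.
exists (`|a| * C + D) => x.
rewrite !fctE mulrDl -mulrA (le_trans (ler_normD _ _))// lerD//.
by rewrite normrZ ler_wpM2l.
Qed.

HB.instance Definition _ :=
  GRing.isSubmodClosed.Build R[i] (H -> H) bounded_operator
    bounded_operator_submod.

Lemma bounded_operator_id : idfun \in bounded_operator.
Proof.
by apply/bounded_operatorP; split=> //; exists 1 => x; rewrite mul1r.
Qed.

Lemma bounded_operator_comp S T :
  S \in bounded_operator -> T \in bounded_operator ->
  S \o T \in bounded_operator.
Proof.
move=> /bounded_operatorP[lS [C hC]] /bounded_operatorP[lT [D hD]].
apply/bounded_operatorP; split; first by move=> a x y; rewrite /= lT lS.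
exists (`|C| * D) => x /=; rewrite (le_trans (hC _))// -mulrA.
have [->|C0] := eqVneq (`|T x|) 0.
  by rewrite mulr0 mulr_ge0// (le_trans _ (hD x)).
have Cge0 : 0 <= C.
  have Tx0 : 0 < `|T x| by rewrite lt_def C0 normr_ge0.
  by rewrite -(pmulr_lge0 _ Tx0) (le_trans _ (hC _)).
by rewrite (ger0_norm Cge0) ler_wpM2l.
Qed.

End BoundedOperators.

Record bop (R : realType) (H : hilbertType R) : Type := Bop {
  bop_fun :> H -> H ;
  bop_funP : bop_fun \in bounded_operator }.

Section BopTheory.
Context {R : realType}.
Variable H : hilbertType R.

HB.instance Definition _ := [isSub for @bop_fun R H].
HB.instance Definition _ := gen_eqMixin (bop H).
HB.instance Definition _ := gen_choiceMixin (bop H).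
HB.instance Definition _ := [SubChoice_isSubLmodule of bop H by <:].

Definition bop_id : bop H := Bop (@bounded_operator_id R H).

Definition bop_comp (S T : bop H) : bop H :=
  Bop (bounded_operator_comp (bop_funP S) (bop_funP T)).

(* S = T^*; such an S exists and is unique for every bounded T. *)
Definition adjoint (T S : bop H) : Prop :=
  forall x y : H, inner (T x) y = inner x (S y).

Definition opnorm (T : bop H) : R :=
  sup [set complex.Re `|T x| | x in [set x : H | `|x| <= 1]].

(* The weak* topology of B(H), as the dual of the trace class operators: the
   weak* continuous functionals are the T |-> \sum_n <T x_n, y_n> with (x_n) and
   (y_n) square summable. *)
Definition square_summable (x : nat -> H) : Prop :=
  cvgn (series (fun n => `|x n| ^+ 2 : R[i]^o)).

Definition square_summable_pair : Type :=
  {xy : (nat -> H) * (nat -> H) |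
    square_summable xy.1 /\ square_summable xy.2}.

Definition normal_functionals (T : bop H) :
    {ptws square_summable_pair -> R[i]^o} :=
  fun xy => limn (series (fun n =>
    inner (T ((sval xy).1 n)) ((sval xy).2 n) : R[i]^o)).

Definition weak_star : topologicalType := initial_topology normal_functionals.

Definition weak_star_closure (A : set (bop H)) : set (bop H) :=
  closure (A : set weak_star).

Definition von_neumann_algebra (M : set (bop H)) : Prop :=
  [/\ M bop_id,
      forall (a : R[i]) S T, M S -> M T -> M (a *: S + T),
      forall S T, M S -> M T -> M (bop_comp S T),
      forall T S, M T -> adjoint T S -> M S &
      weak_star_closure M = M].

(* P is only constrained on B, where it is a projection of the normed space B
   with range S. *)
Definition linear_projection_onto (B S : set (bop H)) (P : bop H -> bop H) :
    Prop :=
  [/\ forall (a : R[i]) T U, B T -> B U -> P (a *: T + U) = a *: P T + P U,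
      S `<=` B,
      P @` B = S &
      forall T, B T -> P (P T) = P T].

Definition complemented (S B : set (bop H)) : Prop :=
  exists P, linear_projection_onto B S P /\
    exists C : R, forall T, B T -> opnorm (P T) <= C * opnorm T.

Definition contractively_complemented (S B : set (bop H)) : Prop :=
  exists P, linear_projection_onto B S P /\
    forall T, B T -> opnorm (P T) <= opnorm T.

End BopTheory.

Section VonNeumannTensor.
Context {R : realType} {H K : hilbertType R}.

(* K, together with the map (x, y) |-> t x y, is the Hilbert space tensor
   product of H with itself: the completion of the algebraic tensor product for
   the inner product determined by
   <x1 (x) y1, x2 (x) y2> = <x1, x2> <y1, y2>. These conditions determine
   (K, t) up to a unique unitary. *)
Definition hilbert_tensor (t : {bilinear H -> H -> K}) : Prop :=
  (forall x1 y1 x2 y2 : H,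
     inner (t x1 y1) (t x2 y2) = inner x1 x2 * inner y1 y2) /\
  closure [set z : K | exists (n : nat) (x y : 'I_n -> H),
     z = \sum_(i < n) t (x i) (y i)] = setT.

(* c = a (x) b *)
Definition tensor_operator (t : {bilinear H -> H -> K}) (a b : bop H)
    (c : bop K) : Prop :=
  forall x y : H, c (t x y) = t (a x) (b y).

Definition algebraic_tensor (t : {bilinear H -> H -> K}) (M N : set (bop H)) :
    set (bop K) :=
  [set T | exists (n : nat) (a b : 'I_n -> bop H) (c : 'I_n -> bop K),
     (forall i, [/\ M (a i), N (b i) & tensor_operator t (a i) (b i) (c i)]) /\
     T = \sum_(i < n) c i].

Definition vn_tensor (t : {bilinear H -> H -> K}) (M N : set (bop H)) :
    set (bop K) :=
  weak_star_closure (algebraic_tensor t M N).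

End VonNeumannTensor.

Section StarHomomorphisms.
Context {R : realType} {K H : hilbertType R}.

(* f is only constrained on A; it is not required to preserve the unit. *)
Definition injective_star_hom (A : set (bop K)) (B : set (bop H))
    (f : bop K -> bop H) : Prop :=
  [/\ forall T, A T -> B (f T),
      forall (a : R[i]) S T, A S -> A T -> f (a *: S + T) = a *: f S + f T,
      forall S T, A S -> A T -> f (bop_comp S T) = bop_comp (f S) (f T),
      forall S T, A S -> A T -> adjoint S T -> adjoint (f S) (f T) &
      forall S T, A S -> A T -> f S = f T -> S = T].

(* A *-isomorphism between von Neumann algebras is automatically a
   homeomorphism for the weak* topologies. *)
Definition vn_isomorphic (A : set (bop K)) (B : set (bop H)) : Prop :=
  exists f, injective_star_hom A B f /\ f @` A = B.

Definition embeds_contractively_complemented (A : set (bop K))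
    (B : set (bop H)) : Prop :=
  exists f, injective_star_hom A B f /\ contractively_complemented (f @` A) B.

End StarHomomorphisms.

(* Main.v *)
Require Import Defs.
From mathcomp Require Import all_boot all_order all_algebra.
From mathcomp Require Import sesquilinear complex.
From mathcomp Require Import all_classical all_reals all_analysis.
From mathcomp Require Import ring lra.

Set Implicit Arguments.
Unset Strict Implicit.
Unset Printing Implicit Defensive.

Import Order.TTheory GRing.Theory Num.Theory.
Import numFieldNormedType.Exports.

Local Open Scope classical_set_scope.
Local Open Scope ring_scope.
Local Open Scope complex_scope.

(** Projection constants are multiplicative under tensor products, while the tensor
    square N of M sits in M as a contractively complemented subalgebra: a finite
    constant that is not smaller than its own square is at most 1. The proof makes
    this effective, without mentioning the optimal constant.

    Dually, a contractive projection of B(H) onto M exists if every finite sum of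
    a_i (x) omega_i, with a_i in M and omega_i a vector functional, has a trace
    Re sum omega_i(a_i) that is at most the supremum of Re sum omega_i(G a_i) over
    the linear contractions G of B(H) into M. Indeed the functions
    G |-> Re <G T x, y> then have a mean, provided by positive_extension, which is
    the expected one for T in M, and mean_projection averages the contractions G
    into a projection.

    Suppose that the inequality fails for a tensor, of trace tau > k, where k bounds
    the values at the contractions, and let P be a projection of B(H) onto M, of
    norm at most C. By tensor_projection there is a projection P' of B(K) onto N of
    norm at most C. In sliced_projection, the sum of the slices
    (id (x) omega_i)(P' (T (x) a_i)) is a map of T with values in M, a multiple of
    the identity on M by a number of real part tau, and of norm at most k C, since
    slicing P' (T (x) S) on the other side is, up to a factor, a contraction applied
    to S.
    So the constant C becomes C k / tau; after finitely many steps it is at most 1.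

    The passage from B(H) to B(K) is Arveson's extension theorem, in
    star_hom_extension: a star homomorphism f of N into B(H) extends to a
    contraction F of B(K) into B(H). It is the positive extension of a functional
    that is positive by complete positivity of f; the latter is reduced by Schur
    complements, in qform_coercive_ge0, to single operators, for which square roots
    and inverses in N are found as fixed points of contractions. *)

(** * The underlying real Hilbert space *)

Lemma conjE (R : realType) (z : R[i]) : Num.conj z = (z^*)%C.
Proof. reflexivity. Qed.

Lemma Re_conj (R : realType) (z : R[i]) : complex.Re (Num.conj z) = complex.Re z.
Proof. by case: z. Qed.

Lemma ReD (R : realType) (z w : R[i]) : complex.Re (z + w) = complex.Re z + complex.Re w.
Proof. by case: z w => ? ? []. Qed.

Lemma Re_realM (R : realType) (r : R) (z : R[i]) : complex.Re (r%:C * z) = r * complex.Re z.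
Proof. by case: z => u v /=; rewrite mul0r subr0. Qed.

Section RealHilbert.
Context {R : realType} {H : hilbertType R}.
Implicit Types (x y z : H) (a : R[i]) (r : R).

(** Together with nrm, this makes H a real Hilbert space. Operators are determined
    by the real parts Re <T x, y>, so that all estimates can take place in R
    instead of R[i]. *)
Definition ri x y : R := complex.Re (inner x y).
Definition nrm x : R := complex.Re `|x|.

Lemma ri_sym x y : ri x y = ri y x.
Proof.
rewrite /ri (@hermitian_subproof _ _ _ _ inner x y) expr0 mul1r.
exact: Re_conj.
Qed.

Lemma riDl x y z : ri (x + y) z = ri x z + ri y z.
Proof. rewrite /ri linearDl; exact: ReD. Qed.

Lemma riZ a x y : ri (a *: x) y = ri x (a^* *: y).
Proof.
rewrite /ri linearZl_LR linearZr_LR /=.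
suff -> : Num.conj (a^*)%C = a by [].
by rewrite conjE conjcK.
Qed.

Lemma riDr x y z : ri x (y + z) = ri x y + ri x z.
Proof. by rewrite ri_sym riDl !(ri_sym x). Qed.

Lemma riZl r x y : ri (r%:C *: x) y = r * ri x y.
Proof.
rewrite /ri linearZl_LR /=; exact: Re_realM.
Qed.

Lemma riZr r x y : ri x (r%:C *: y) = r * ri x y.
Proof. by rewrite ri_sym riZl ri_sym. Qed.

Lemma riZ_conj a x y : ri x (a *: y) = ri (a^* *: x) y.
Proof. by rewrite ri_sym riZ ri_sym. Qed.

Lemma riNl x y : ri (- x) y = - ri x y.
Proof. by rewrite -scaleN1r -[-1]/(- 1%:C) -rmorphN riZl mulN1r. Qed.

Lemma riNr x y : ri x (- y) = - ri x y.
Proof. by rewrite ri_sym riNl ri_sym. Qed.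

Lemma riBl x y z : ri (x - y) z = ri x z - ri y z.
Proof. by rewrite riDl riNl. Qed.

Lemma riBr x y z : ri x (y - z) = ri x y - ri x z.
Proof. by rewrite riDr riNr. Qed.

Lemma ri0l y : ri 0 y = 0.
Proof. by rewrite -(subrr 0) riBl subrr. Qed.

Lemma ri0r x : ri x 0 = 0.
Proof. by rewrite ri_sym ri0l. Qed.

Lemma ri_suml I (s : seq I) (P : pred I) (F : I -> H) y :
  ri (\sum_(i <- s | P i) F i) y = \sum_(i <- s | P i) ri (F i) y.
Proof. by apply: (big_morph (fun x => ri x y)) => [u v|]; rewrite ?riDl ?ri0l. Qed.

Lemma ri_sumr I (s : seq I) (P : pred I) (F : I -> H) x :
  ri x (\sum_(i <- s | P i) F i) = \sum_(i <- s | P i) ri x (F i).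
Proof. by rewrite ri_sym ri_suml; under eq_bigr do rewrite ri_sym. Qed.

Lemma normE x : `|x| = (nrm x)%:C.
Proof. by rewrite RRe_real// ger0_real. Qed.

Lemma nrm_ge0 x : 0 <= nrm x.
Proof. by rewrite -ler0c -normE. Qed.

Lemma sqr_nrm x : nrm x ^+ 2 = ri x x.
Proof. by rewrite /ri -sqr_norm_inner normE -rmorphXn. Qed.

Lemma ri_ge0 x : 0 <= ri x x. Proof. by rewrite -sqr_nrm exprn_ge0 ?nrm_ge0. Qed.

Lemma nrm0_eq0 x : nrm x = 0 -> x = 0.
Proof. by move=> x0; apply/normr0_eq0; rewrite normE x0. Qed.

Lemma ri0_eq0 x : ri x x = 0 -> x = 0.
Proof. by rewrite -sqr_nrm => /eqP; rewrite sqrf_eq0 => /eqP/nrm0_eq0. Qed.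

Lemma nrm0 : nrm (0 : H) = 0. Proof. by rewrite /nrm normr0. Qed.

Lemma nrmZ a x : nrm (a *: x) = complex.Re `|a| * nrm x.
Proof.
rewrite /nrm normrZ normE; case: `|a| => u v /=.
by rewrite mulr0 subr0.
Qed.

Lemma nrmZr r x : nrm (r%:C *: x) = `|r| * nrm x.
Proof. by rewrite nrmZ normc_def /= expr0n addr0 sqrtr_sqr. Qed.

Lemma nrmN x : nrm (- x) = nrm x. Proof. by rewrite /nrm normrN. Qed.

Lemma nrmB x y : nrm (x - y) = nrm (y - x). Proof. by rewrite -nrmN opprB. Qed.

Lemma nrmD x y : nrm (x + y) <= nrm x + nrm y.
Proof. by rewrite -lecR rmorphD /= -!normE ler_normD. Qed.

Lemma nrmi x : nrm ('i *: x) = nrm x.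
Proof. by rewrite nrmZ normc_def /= expr0n add0r expr1n sqrtr1 mul1r. Qed.

Lemma ri_le_sqr x y : 2 * ri x y <= nrm x ^+ 2 + nrm y ^+ 2.
Proof.
have := ri_ge0 (x - y); rewrite !sqr_nrm riBl !riBr (ri_sym y x) => h.
lra.
Qed.

Lemma cauchy_schwarz x y : ri x y <= nrm x * nrm y.
Proof.
have := nrm_ge0 x; rewrite le_eqVlt => /orP[/eqP/esym x0|x0].
  by rewrite x0 mul0r (nrm0_eq0 x0) ri0l.
have := nrm_ge0 y; rewrite le_eqVlt => /orP[/eqP/esym y0|y0].
  by rewrite y0 mulr0 (nrm0_eq0 y0) ri0r.
have := ri_le_sqr ((nrm y)%:C *: x) ((nrm x)%:C *: y).
rewrite riZl riZr !nrmZr !gtr0_norm// => h.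
by rewrite -(ler_pM2l (mulr_gt0 y0 x0)); nra.
Qed.

Lemma abs_ri x y : `|ri x y| <= nrm x * nrm y.
Proof.
rewrite ler_norml cauchy_schwarz andbT -(nrmN x).
by rewrite lerNl -riNl cauchy_schwarz.
Qed.

Lemma ri_eq x y : (forall z, ri x z = ri y z) -> x = y.
Proof.
by move=> e; apply/eqP; rewrite -subr_eq0; apply/eqP/ri0_eq0; rewrite riBl e subrr.
Qed.

Lemma nrm_le_ri x (C : R) : 0 <= C -> (forall y, ri x y <= C * nrm y) -> nrm x <= C.
Proof.
move=> C0 h; have := nrm_ge0 x; rewrite le_eqVlt => /orP[/eqP <-//|x0].
by rewrite -(ler_pM2r x0) -expr2 sqr_nrm.
Qed.

Lemma parallelogram x y :
  nrm (x - y) ^+ 2 + nrm (x + y) ^+ 2 = 2 * nrm x ^+ 2 + 2 * nrm y ^+ 2.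
Proof. rewrite !sqr_nrm riBl riDl !riBr !riDr (ri_sym y x); ring. Qed.

End RealHilbert.

(** * Limits of sequences with geometric increments *)

Section GeometricLimits.
Context {R : realType}.

Lemma exp_small (r e : R) : 0 <= r < 1 -> 0 < e -> exists n : nat, r ^+ n < e.
Proof.
move=> /andP[r0 r1] e0; have /cvgrPdist_lt/(_ _ e0) : (r ^+ n @[n --> \oo] --> (0:R))%classic.
  by apply: cvg_expr; rewrite ger0_norm.
case=> n _ /(_ n (leqnn n)) /=; rewrite sub0r normrN ger0_norm ?exprn_ge0// => hn.
by exists n.
Qed.

Lemma le0_geometric (r C x : R) : 0 <= r < 1 -> (forall n : nat, x <= C * r ^+ n) -> x <= 0.
Proof.
move=> r01 h; rewrite leNgt; apply/negP => x0.
have C0 : 0 < C by have := h 0%N; rewrite expr0 mulr1; apply: lt_le_trans.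
have [n hn] := exp_small r01 (divr_gt0 x0 C0).
by have := h n; rewrite leNgt mulrC -ltr_pdivlMr// hn.
Qed.

Lemma geometric_tail (H : hilbertType R) (u : nat -> H) (C r : R) : 0 <= r < 1 ->
  (forall n, nrm (u n.+1 - u n) <= C * r ^+ n) ->
  forall n m, (n <= m)%N -> nrm (u m - u n) <= C / (1 - r) * r ^+ n.
Proof.
move=> /andP[r0 r1] h n m nm.
have r1' : 0 < 1 - r by rewrite subr_gt0.
have C0 : 0 <= C by have := le_trans (nrm_ge0 _) (h 0%N); rewrite expr0 mulr1.
suff : nrm (u m - u n) <= C / (1 - r) * (r ^+ n - r ^+ m).
  move=> /le_trans; apply; rewrite ler_wpM2l ?divr_ge0 ?(ltW r1')//.
  by rewrite gerBl exprn_ge0.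
rewrite -(subnKC nm); elim: (m - n)%N => [|k IH].
  by rewrite addn0 !subrr nrm0 mulr0.
rewrite addnS -(subrKA (u (n + k)%N)).
rewrite (le_trans (nrmD _ _))// (le_trans (lerD (h _) IH))// exprS.
rewrite le_eqVlt; apply/orP; left; apply/eqP; field; exact: lt0r_neq0.
Qed.

Lemma geometric_limit (H : hilbertType R) (u : nat -> H) (C r : R) : 0 <= r < 1 ->
  (forall n, nrm (u n.+1 - u n) <= C * r ^+ n) ->
  exists l, forall n, nrm (u n - l) <= C / (1 - r) * r ^+ n.
Proof.
move=> r01 h; have tail := geometric_tail r01 h.
set D := C / (1 - r) in tail *.
have cu : cauchy (u @ \oo).
  apply: cauchy_exP => e e0.
  have e0' : 0 < complex.Re e by move: e0; rewrite ltcE => /andP[].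
  have eE : e = (complex.Re e)%:C by rewrite RRe_real// gtr0_real.
  have [n hn] : exists n, D * r ^+ n < complex.Re e.
    apply: contrapT => /forallNP hN.
    have : complex.Re e <= 0.
      by apply: (le0_geometric r01) => n; rewrite leNgt; apply/negP/hN.
    by rewrite leNgt e0'.
  exists (u n); exists n => // m /= nm.
  rewrite -ball_normE /= eE normE ltcR nrmB.
  exact: le_lt_trans (tail _ _ nm) hn.
have /cvg_ex[l ul] : cvgn u by apply: cauchy_cvg.
exists l => n; apply/ler_addgt0Pr => e e0.
have /cvgrPdist_lt/(_ e%:C) := ul.
rewrite ltcR => /(_ e0)[m _ hm].
have := hm (maxn m n) (leq_maxl _ _) => /=; rewrite normE ltcR => hl.
rewrite -(subrKA (u (maxn m n))) (le_trans (nrmD _ _))// lerD//.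
  by rewrite nrmB tail// leq_maxr.
by rewrite nrmB ltW.
Qed.

End GeometricLimits.

(** * Bounded operators *)

Section OperatorNorm.
Context {R : realType} {H : hilbertType R}.
Implicit Types (T S : bop H) (x y : H) (a : R[i]).

Lemma bopP T S : T =1 S -> T = S.
Proof. by move=> e; apply: val_inj; apply/funext. Qed.

Lemma bopDE T S x : (T + S) x = T x + S x. Proof. by []. Qed.
Lemma bopZE a T x : (a *: T) x = a *: T x. Proof. by []. Qed.
Lemma bopNE T x : (- T) x = - T x. Proof. by []. Qed.
Lemma bopBE T S x : (T - S) x = T x - S x. Proof. by []. Qed.
Lemma bop0E x : (0 : bop H) x = 0. Proof. by []. Qed.

Lemma bop_sumE I (s : seq I) (P : pred I) (F : I -> bop H) x :
  (\sum_(i <- s | P i) F i) x = \sum_(i <- s | P i) F i x.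
Proof. by apply: (big_morph (fun T : bop H => T x)). Qed.

Lemma bop_lin T a x y : T (a *: x + y) = a *: T x + T y.
Proof. by have /bounded_operatorP[-> _] := bop_funP T. Qed.

Lemma bopD T x y : T (x + y) = T x + T y.
Proof. by have := bop_lin T 1 x y; rewrite !scale1r. Qed.

Lemma bop0 T : T 0 = 0.
Proof. by have /esym := bopD T 0 0; rewrite addr0 => /(canRL (addrK _)); rewrite subrr. Qed.

Lemma bopZ T a x : T (a *: x) = a *: T x.
Proof. by have := bop_lin T a x 0; rewrite bop0 !addr0. Qed.

Lemma bop_sum T I (s : seq I) (P : pred I) (F : I -> H) :
  T (\sum_(i <- s | P i) F i) = \sum_(i <- s | P i) T (F i).
Proof. by apply: big_morph => [x y|]; [exact: bopD | exact: bop0]. Qed.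

Lemma bop_bounded T : exists2 C : R, 0 <= C & forall x, nrm (T x) <= C * nrm x.
Proof.
have /bounded_operatorP[_ [C hC]] := bop_funP T.
exists `|complex.Re C| => [//|x]; rewrite (@le_trans _ _ (complex.Re C * nrm x))//.
  have := hC x; rewrite !normE lecE => /andP[_ /= /le_trans]; apply.
  by case: (C) => u v /=; rewrite mulr0 subr0.
by rewrite ler_wpM2r ?nrm_ge0// ler_norm.
Qed.

Lemma has_sup_opnorm T :
  has_sup [set complex.Re `|T x| | x in [set x : H | `|x| <= 1]].
Proof.
have [C C0 hC] := bop_bounded T; split.
  by exists (complex.Re `|T 0|), 0 => //=; rewrite normr0 ler01.
exists C => _ [x /= x1 <-]; rewrite (le_trans (hC x))//.
by rewrite ler_piMr// -lecR -normE.
Qed.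

Lemma opnorm_le T (C : R) : 0 <= C ->
  (forall x, nrm (T x) <= C * nrm x) -> opnorm T <= C.
Proof.
move=> C0 hC; apply: ge_sup.
  by exists (complex.Re `|T 0|), 0 => //=; rewrite normr0 ler01.
move=> _ [x /= x1 <-]; rewrite (le_trans (hC x))//.
by rewrite ler_piMr// -lecR -normE.
Qed.

Lemma nrm_opnorm T x : nrm (T x) <= opnorm T * nrm x.
Proof.
have := nrm_ge0 x; rewrite le_eqVlt => /orP[/eqP/esym x0|x0].
  by rewrite x0 mulr0 (nrm0_eq0 x0) bop0 nrm0.
rewrite -ler_pdivrMr//; apply: sup_upper_bound; first exact: has_sup_opnorm.
have xi0 : 0 <= (nrm x)^-1 by rewrite invr_ge0 ltW.
exists ((nrm x)^-1%:C *: x) => /=.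
  by rewrite normE nrmZr (ger0_norm xi0) mulVf ?gt_eqF.
rewrite bopZ -/(nrm _) nrmZr (ger0_norm xi0).
by rewrite mulrC.
Qed.

Lemma opnorm_ge0 T : 0 <= opnorm T.
Proof.
apply: le_trans (_ : complex.Re `|T 0| <= _); first by rewrite -/(nrm _) nrm_ge0.
apply: sup_upper_bound; first exact: has_sup_opnorm.
by exists 0 => //=; rewrite normr0 ler01.
Qed.

Lemma nrm_bop_le T x (C : R) : opnorm T <= C -> nrm (T x) <= C * nrm x.
Proof. by move=> h; rewrite (le_trans (nrm_opnorm T x))// ler_wpM2r ?nrm_ge0. Qed.

Lemma opnormD T S : opnorm (T + S) <= opnorm T + opnorm S.
Proof.
apply: opnorm_le => [|x]; first by rewrite addr_ge0 ?opnorm_ge0.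
by rewrite mulrDl (le_trans (nrmD _ _))// lerD ?nrm_opnorm.
Qed.

Lemma opnormZr (r : R) T : opnorm (r%:C *: T) <= `|r| * opnorm T.
Proof.
apply: opnorm_le => [|x]; first by rewrite mulr_ge0 ?opnorm_ge0.
by rewrite bopZE nrmZr -mulrA ler_wpM2l ?nrm_opnorm.
Qed.

Lemma opnormN T : opnorm (- T) = opnorm T.
Proof.
have h S : opnorm (- S) <= opnorm S.
  apply: opnorm_le => [|x]; first exact: opnorm_ge0.
  by rewrite bopNE nrmN nrm_opnorm.
by apply/le_anti; rewrite h -{1}(opprK T) h.
Qed.

Lemma opnormB T S : opnorm (T - S) = opnorm (S - T).
Proof. by rewrite -opnormN opprB. Qed.

Lemma opnorm_comp T S : opnorm (bop_comp T S) <= opnorm T * opnorm S.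
Proof.
apply: opnorm_le => [|x]; first by rewrite mulr_ge0 ?opnorm_ge0.
by rewrite /= (le_trans (nrm_opnorm _ _))// -mulrA ler_wpM2l ?opnorm_ge0 ?nrm_opnorm.
Qed.

Lemma opnorm0_eq0 T : opnorm T <= 0 -> T = 0.
Proof.
move=> h; apply: bopP => x; apply: nrm0_eq0; apply/le_anti.
by rewrite nrm_ge0 andbT (le_trans (nrm_bop_le x h))// mul0r.
Qed.

Lemma opnorm_0 : opnorm (0 : bop H) = 0.
Proof.
apply/le_anti; rewrite opnorm_ge0 andbT opnorm_le// => x.
by rewrite bop0E nrm0 mul0r.
Qed.

Lemma make_bop (f : H -> H) (C : R) :
  (forall a x y, f (a *: x + y) = a *: f x + f y) ->
  (forall x, nrm (f x) <= C * nrm x) -> exists T : bop H, T =1 f.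
Proof.
move=> lf bf; suff h : f \in bounded_operator by exists (Bop h).
apply/bounded_operatorP; split=> //; exists C%:C => x.
by rewrite !normE -rmorphM /= lecR.
Qed.

End OperatorNorm.

(** * The Riesz representation theorem and adjoints *)

Section Riesz.
Context {R : realType} {H : hilbertType R}.
Implicit Types (x y z u : H) (a : R[i]) (r : R).

(** First-order condition at an approximate minimum, read off at t = e and t = -e. *)
Lemma quadratic_ge0 (s q e : R) : 0 <= q -> 0 < e ->
  (forall t : R, - e ^+ 2 <= 2 * t * s + t ^+ 2 * q) -> `|s| <= e * (1 + q) / 2.
Proof.
move=> q0 e0 h.
have h1 := h e; have h2 := h (- e).
rewrite ler_norml; apply/andP; split; rewrite -(ler_pM2l e0); nra.
Qed.

(** The functional is given by its graph, so that it may be defined on any real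
    subspace and need not be exhibited as a function. Its representative is the
    limit of a sequence minimizing |u|^2 - 2 r over the graph; the parallelogram
    law makes the increments of this sequence geometric. *)
Lemma riesz_graph (G : H -> R -> Prop) (C : R) : 0 <= C ->
  G 0 0 ->
  (forall k u r v s, G u r -> G v s -> G (k%:C *: u + v) (k * r + s)) ->
  (forall u r, G u r -> `|r| <= C * nrm u) ->
  exists2 z, forall u r, G u r -> ri z u = r & nrm z <= C.
Proof.
move=> C0 G0 GL GB.
pose J u r : R := nrm u ^+ 2 - 2 * r.
pose E : set R := [set j | exists u r, G u r /\ j = J u r].
have lbE : has_inf E.
  split; first by exists (J 0 0), 0, 0.
  exists (- C ^+ 2) => _ [u [r [Gur ->]]].
  have := GB _ _ Gur; rewrite ler_norml /J => /andP[_ h].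
  have := sqr_ge0 (nrm u - C); nra.
pose m := inf E.
have mle u r : G u r -> m <= J u r.
  by move=> Gur; apply: ge_inf; [exact: lbE.2 | exists u, r].
have ex (n : nat) : exists p : H * R, G p.1 p.2 /\ J p.1 p.2 < m + (2^-1 ^+ n) ^+ 2.
  have e0 : 0 < (2^-1 ^+ n : R) ^+ 2 by rewrite exprn_gt0 ?exprn_gt0 ?invr_gt0.
  have [_ [u [r [Gur ->]]] lt] := inf_adherent e0 lbE.
  by exists (u, r).
have [p hp] := choice ex.
have step n : nrm ((p n.+1).1 - (p n).1) <= 2 * 2^-1 ^+ n.
  have [G1 J1] := hp n.+1; have [G2 J2] := hp n.
  set e := 2^-1 ^+ n in J2 *.
  have e0 : 0 < e by rewrite exprn_gt0 ?invr_gt0.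
  have Gm := GL 2^-1 _ _ _ _ G1 (GL 2^-1 _ _ _ _ G2 G0).
  have := mle _ _ Gm; rewrite /J !addr0 -scalerDr nrmZr => Jm.
  have := parallelogram (p n.+1).1 (p n).1.
  move: J1 J2 Jm; rewrite /J (exprS _ n) -/e.
  have -> : `|2^-1| = 2^-1 :> R by rewrite ger0_norm.
  set B := nrm ((p n.+1).1 - (p n).1); set A := nrm (_ + _).
  have B0 : 0 <= B by exact: nrm_ge0.
  move=> J1 J2 Jm pl.
  rewrite -(@ler_pXn2r _ 2) ?nnegrE//; last by rewrite mulr_ge0 ?ltW.
  rewrite !exprMn in J1 J2 Jm *.
  have e2 : 0 < e ^+ 2 by rewrite exprn_gt0.
  lra.
have half01 : 0 <= (2^-1 : R) < 1 by apply/andP; split; lra.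
have [z hz] := geometric_limit half01 step.
have Gz u r : G u r -> ri z u = r.
  move=> Gur; apply/eqP; rewrite -subr_eq0 -normr_le0.
  pose D := 2 / (1 - 2^-1) * nrm u + (1 + nrm u ^+ 2) / 2.
  apply: (@le0_geometric _ 2^-1 D) => // n.
  have [Gn Jn] := hp n; set e := 2^-1 ^+ n in Jn *.
  have e0 : 0 < e by rewrite exprn_gt0 ?invr_gt0.
  have -> : ri z u - r = - ri ((p n).1 - z) u + (ri (p n).1 u - r).
    rewrite riBl; ring.
  rewrite (le_trans (ler_normD _ _))// normrN.
  have h1 : `|ri ((p n).1 - z) u| <= 2 / (1 - 2^-1) * e * nrm u.
    by rewrite (le_trans (abs_ri _ _))// ler_wpM2r ?nrm_ge0// hz.
  have h2 : `|ri (p n).1 u - r| <= e * (1 + nrm u ^+ 2) / 2.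
    apply: quadratic_ge0; [by rewrite exprn_ge0 ?nrm_ge0 | by [] | move=> t].
    have := mle _ _ (GL t _ _ _ _ Gur Gn); rewrite /J in Jn *.
    rewrite !sqr_nrm riDl !riDr !riZl !riZr (ri_sym (p n).1) -!sqr_nrm => h.
    nra.
  rewrite /D; nra.
exists z => //.
have zz : nrm z ^+ 2 - C * nrm z <= 0.
  apply: (@le0_geometric _ 2^-1 ((nrm z + C) * (2 / (1 - 2^-1)))) => // n.
  have [Gn _] := hp n; have := hz n.
  set e := 2^-1 ^+ n; set u := (p n).1 => hn.
  have h1 : ri z u <= C * nrm u.
    by rewrite (Gz _ _ Gn) (le_trans (ler_norm _))// GB.
  have h2 : ri z (z - u) <= nrm z * nrm (u - z) by rewrite nrmB cauchy_schwarz.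
  have h3 : nrm u <= nrm (u - z) + nrm z by rewrite -{1}(subrK z u) nrmD.
  have z0 := nrm_ge0 z.
  move: h2; rewrite riBr -sqr_nrm => h2.
  have h4 : C * nrm u <= C * (nrm (u - z) + nrm z) by rewrite ler_wpM2l.
  have h5 : (nrm z + C) * nrm (u - z) <= (nrm z + C) * (2 / (1 - 2^-1) * e).
    by rewrite ler_wpM2l// addr_ge0.
  rewrite -mulrA; apply: le_trans h5; lra.
have := nrm_ge0 z; rewrite le_eqVlt => /orP[/eqP <-//|z0].
by rewrite -(ler_pM2r z0) -expr2 -subr_le0.
Qed.

(** The condition on complex scalars is the one satisfied by Re <T x, y>; it makes
    the operator, obtained from real data only, complex linear. *)
Lemma bop_of_form (rho : H -> H -> R) (C : R) : 0 <= C ->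
  (forall a x x' y, rho (a *: x + x') y = rho x (a^* *: y) + rho x' y) ->
  (forall k x y y', rho x (k%:C *: y + y') = k * rho x y + rho x y') ->
  (forall x y, rho x y <= C * nrm x * nrm y) ->
  exists2 T : bop H, forall x y, ri (T x) y = rho x y & opnorm T <= C.
Proof.
move=> C0 rhol rhor rhob.
have rho0 x : rho x 0 = 0.
  have := rhor 1 x 0 0; rewrite scaler0 addr0 mul1r => h; lra.
have ex x : exists z, (forall y, ri z y = rho x y) /\ nrm z <= C * nrm x.
  have [||||z hz zC] := @riesz_graph (fun y r => r = rho x y) (C * nrm x).
  - by rewrite mulr_ge0 ?nrm_ge0.
  - by rewrite rho0.
  - by move=> k u r v s -> ->; rewrite rhor.
  - move=> y _ ->; rewrite ler_norml rhob andbT lerNl.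
    have := rhor (-1) x y 0; rewrite !addr0 rho0 addr0 mulN1r => <-.
    by rewrite (le_trans (rhob _ _))// nrmZr normrN1 mul1r.
  by exists z; split=> // y; apply: hz.
have [f hf] := choice ex.
have [||T Tf] := @make_bop _ _ f C.
- move=> a x x'; apply: ri_eq => y; rewrite (hf _).1 rhol riDl riZ.
  by rewrite !(hf _).1.
- by move=> x; apply: (hf x).2.
exists T; first by move=> x y; rewrite Tf (hf x).1.
by apply: opnorm_le => // x; rewrite Tf; apply: (hf x).2.
Qed.

Lemma adjointP (T S : bop H) :
  adjoint T S <-> forall x y, ri (T x) y = ri x (S y).
Proof.
split=> [h x y|h x y]; first by rewrite /ri h.
apply/eqP; rewrite eq_complex; apply/andP; split; first by apply/eqP/h.
have e u v : complex.Im (inner u v : R[i]) = ri u ('i *: v).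
  rewrite /ri linearZr_LR /=; move: (inner u v : R[i]) => -[p q] /=.
  by rewrite mul0r sub0r mulN1r opprK.
by rewrite !e h bopZ.
Qed.

Lemma adjoint_exists (T : bop H) : exists S, adjoint T S.
Proof.
have [||||S hS _] := @bop_of_form (fun x y => ri x (T y)) (opnorm T).
- exact: opnorm_ge0.
- by move=> a x x' y; rewrite riDl riZ bopZ.
- by move=> k x y y'; rewrite bop_lin riDr riZr.
- move=> x y; rewrite (le_trans (cauchy_schwarz _ _))// mulrAC mulrC.
  by rewrite ler_wpM2r ?nrm_ge0 ?nrm_opnorm.
by exists S; apply/adjointP => x y; rewrite ri_sym -hS ri_sym.
Qed.

Definition adj (T : bop H) : bop H := projT1 (cid (adjoint_exists T)).

Lemma adj_adjoint (T : bop H) : adjoint T (adj T).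
Proof. by rewrite /adj; case: cid. Qed.

Lemma ri_adj (T : bop H) x y : ri (T x) y = ri x (adj T y).
Proof. exact: (adjointP _ _).1 (adj_adjoint T) x y. Qed.

Lemma ri_adjl (T : bop H) x y : ri (adj T x) y = ri x (T y).
Proof. by rewrite ri_sym -ri_adj ri_sym. Qed.

Lemma adj_uniq (T S : bop H) : (forall x y, ri (T x) y = ri x (S y)) -> S = adj T.
Proof. by move=> h; apply: bopP => y; apply: ri_eq => x; rewrite ri_sym -h ri_adjl ri_sym. Qed.

Lemma adjointE (T S : bop H) : adjoint T S -> S = adj T.
Proof. by move/adjointP/adj_uniq. Qed.

Lemma adjK (T : bop H) : adj (adj T) = T.
Proof. by apply/esym/adj_uniq => x y; rewrite ri_adjl. Qed.

Lemma adj_comp (T S : bop H) : adj (bop_comp T S) = bop_comp (adj S) (adj T).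
Proof. by apply/esym/adj_uniq => x y /=; rewrite !ri_adj. Qed.

Lemma adjD (T S : bop H) : adj (T + S) = adj T + adj S.
Proof. by apply/esym/adj_uniq => x y; rewrite !bopDE riDl riDr !ri_adj. Qed.

Lemma adjZr r (T : bop H) : adj (r%:C *: T) = r%:C *: adj T.
Proof. by apply/esym/adj_uniq => x y; rewrite !bopZE riZl riZr ri_adj. Qed.

Lemma adjN (T : bop H) : adj (- T) = - adj T.
Proof. by apply/esym/adj_uniq => x y; rewrite !bopNE riNl riNr ri_adj. Qed.

Lemma adjB (T S : bop H) : adj (T - S) = adj T - adj S.
Proof. by rewrite adjD adjN. Qed.

Lemma adj0 : adj 0 = 0 :> bop H.
Proof. by have := adjB 0 0; rewrite !subrr. Qed.

Lemma adj_id : adj (bop_id H) = bop_id H.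
Proof. by apply/esym/adj_uniq. Qed.

Lemma opnorm_adj (T : bop H) : opnorm (adj T) <= opnorm T.
Proof.
apply: opnorm_le => [|x]; first exact: opnorm_ge0.
apply: nrm_le_ri => [|y]; first by rewrite mulr_ge0 ?opnorm_ge0 ?nrm_ge0.
rewrite ri_adjl (le_trans (cauchy_schwarz _ _))// mulrAC mulrC.
by rewrite ler_wpM2r ?nrm_ge0 ?nrm_opnorm.
Qed.

End Riesz.

(** * Normal functionals *)

Section ComplexLimits.
Context {R : realType}.

Lemma ltr_normRe (z : R[i]) (e : R) : `|z| < e%:C -> `|complex.Re z| < e.
Proof. by move=> h; rewrite -ltcR (le_lt_trans (normc_ge_Re z)). Qed.

Lemma cvg_Re T (F : set_system T) {FF : Filter F} (u : T -> R[i]^o) (l : R[i]) :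
  u @ F --> (l : R[i]^o) -> complex.Re (u x) @[x --> F] --> complex.Re l.
Proof.
move=> ul; apply/cvgrPdist_lt => e e0.
have /cvgrPdist_lt/(_ e%:C) := ul; rewrite ltcR => /(_ e0).
by apply: filterS => x /ltr_normRe; case: (l) (u x) => ? ? [].
Qed.

Lemma cvg_complex (u v : nat -> R) (a b : R) :
  u @ \oo --> a -> v @ \oo --> b ->
  (fun n => u n +i* v n : R[i]^o) @ \oo --> (a +i* b : R[i]^o).
Proof.
move=> ua vb; apply/cvgrPdist_lt => e e0.
have e0' : 0 < complex.Re e by move: e0; rewrite ltcE => /andP[].
have -> : e = (complex.Re e)%:C by rewrite RRe_real// gtr0_real.
have e2 : 0 < complex.Re e / 2 by rewrite divr_gt0.
have /cvgrPdist_lt/(_ _ e2) ua' := ua; have /cvgrPdist_lt/(_ _ e2) vb' := vb.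
near=> n.
have h1 : `|a - u n| < complex.Re e / 2 by near: n.
have h2 : `|b - v n| < complex.Re e / 2 by near: n.
have -> : (a +i* b : R[i]^o) - (u n +i* v n) = (a - u n)%:C + (b - v n)%:C * 'i.
  by apply/eqP; rewrite eq_complex /=; apply/andP; split; apply/eqP; ring.
rewrite (le_lt_trans (ler_normD _ _))// normrM !normc_def /= !expr0n /=.
rewrite !addr0 add0r expr1n sqrtr1 !sqrtr_sqr mulr1 -rmorphD ltcR.
by rewrite (splitr (complex.Re e)) ltrD.
Unshelve. all: by end_near. Qed.

End ComplexLimits.

Section NormalFunctionals.
Context {R : realType} {H : hilbertType R}.
Implicit Types (T S : bop H) (p : @square_summable_pair R H).

Definition sqsum (x : nat -> H) : Prop := cvgn (series (fun n => nrm (x n) ^+ 2)).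

Lemma square_summableP (x : nat -> H) : square_summable x <-> sqsum x.
Proof.
have e n : series (fun n => `|x n| ^+ 2 : R[i]^o) n
         = (series (fun n => nrm (x n) ^+ 2) n +i* 0 : R[i]^o).
  rewrite !seriesEnat /= complexr0 rmorph_sum /=.
  by apply: eq_bigr => i _; rewrite normE rmorphXn.
split=> /cvg_ex[l hl]; apply/cvg_ex.
  exists (complex.Re l); apply: cvg_trans (cvg_Re hl).
  by apply: near_eq_cvg; near=> n; rewrite e.
exists (l +i* 0 : R[i]^o); rewrite (_ : series _ =
    fun n => (series (fun n => nrm (x n) ^+ 2) n +i* 0 : R[i]^o)).
  by apply: cvg_complex => //; exact: cvg_cst.
by apply/funext => n; rewrite e.
Unshelve. all: by end_near. Qed.

Definition seq1 p := (sval p).1.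
Definition seq2 p := (sval p).2.

Definition mkpair (x y : nat -> H) (hx : sqsum x) (hy : sqsum y) :
    @square_summable_pair R H :=
  exist _ (x, y) (conj ((square_summableP x).2 hx) ((square_summableP y).2 hy)).

Lemma sqsum1 p : sqsum (seq1 p).
Proof. exact: (square_summableP (seq1 p)).1 (proj1 (svalP p)). Qed.

Lemma sqsum2 p : sqsum (seq2 p).
Proof. exact: (square_summableP (seq2 p)).1 (proj2 (svalP p)). Qed.

(** By the inequality 2 |a b| <= a^2 + b^2, the terms of the functional of p at T
    are dominated by those of mass p, up to the factor opnorm T. *)
Definition mass p : nat -> R := series (fun n =>
  2^-1 * (nrm (seq1 p n) ^+ 2 + nrm (seq2 p n) ^+ 2)).

Lemma is_cvg_mass p : cvgn (mass p).
Proof.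
have -> : mass p = 2^-1 \*: (series (fun n => nrm (seq1 p n) ^+ 2) +
    series (fun n => nrm (seq2 p n) ^+ 2)).
  apply/funext => n; rewrite /mass !seriesEnat /= !fctE /= -big_split /=.
  by rewrite scaler_sumr.
by apply: is_cvgZr; apply: is_cvgD; [exact: sqsum1 | exact: sqsum2].
Qed.

Lemma mass_nd p : {homo mass p : n m / (n <= m)%N >-> n <= m}.
Proof.
move=> n m nm; rewrite /mass -subr_ge0 sub_series_geq//.
by apply: sumr_ge0 => i _; rewrite mulr_ge0 ?invr_ge0// addr_ge0 ?exprn_ge0 ?nrm_ge0.
Qed.

(** The error of the partial sums of the functional of p, uniformly on the unit
    ball of B(H). *)
Definition tail p N : R := limn (mass p) - mass p N.

Lemma tail_ge0 p N : 0 <= tail p N.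
Proof.
rewrite subr_ge0; apply: nondecreasing_cvgn_le; last exact: is_cvg_mass.
exact: mass_nd.
Qed.

Lemma tail_small p (e : R) : 0 < e -> exists N, tail p N < e.
Proof.
move=> e0; have h : mass p @ \oo --> limn (mass p) by exact: is_cvg_mass.
have /cvgrPdist_lt/(_ _ e0)[N _ /(_ N (leqnn N))] := h.
by move=> /ltr_normlW tN; exists N.
Qed.

Definition pairing T p : nat -> R := fun n => ri (T (seq1 p n)) (seq2 p n).

Lemma pairing_bound T p n :
  `|pairing T p n| <= opnorm T * (2^-1 * (nrm (seq1 p n) ^+ 2 + nrm (seq2 p n) ^+ 2)).
Proof.
rewrite (le_trans (abs_ri _ _))//.
rewrite (le_trans (ler_wpM2r (nrm_ge0 _) (nrm_opnorm _ _)))// -mulrA.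
rewrite ler_wpM2l ?opnorm_ge0//; have := sqr_ge0 (nrm (seq1 p n) - nrm (seq2 p n)).
nra.
Qed.

Lemma pairing_tail T p n m : (n <= m)%N ->
  `|series (pairing T p) m - series (pairing T p) n| <= opnorm T * (mass p m - mass p n).
Proof.
move=> nm; rewrite /mass !sub_series_geq// (le_trans (ler_norm_sum _ _ _))//.
by rewrite mulr_sumr; apply: ler_sum => i _; exact: pairing_bound.
Qed.

Lemma is_cvg_pairing T p : cvgn (series (pairing T p)).
Proof.
apply: normed_cvg.
apply: (@series_le_cvg _ _ (fun n => opnorm T * (2^-1 * (nrm (seq1 p n) ^+ 2 + nrm (seq2 p n) ^+ 2)))).
- by move=> n /=.
- by move=> n; rewrite mulr_ge0 ?opnorm_ge0 ?mulr_ge0 ?invr_ge0 ?addr_ge0 ?exprn_ge0 ?nrm_ge0.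
- by move=> n; exact: pairing_bound.
- have -> : series (fun n => opnorm T * (2^-1 * (nrm (seq1 p n) ^+ 2 + nrm (seq2 p n) ^+ 2)))
    = opnorm T \*: mass p.
    by apply/funext => n; rewrite /mass !seriesEnat /= -scaler_sumr.
  by apply: is_cvgZr; exact: is_cvg_mass.
Qed.

(** The real part of a normal functional; real parts suffice since the imaginary
    part is the real part for another pair. *)
Definition rnormal p T : R := limn (series (pairing T p)).

Lemma rnormal_tail p T N :
  `|rnormal p T - series (pairing T p) N| <= opnorm T * tail p N.
Proof.
have h : `|series (pairing T p) n - series (pairing T p) N| @[n --> \oo] -->
    `|rnormal p T - series (pairing T p) N|.
  by apply: cvg_norm; apply: cvgB; [exact: is_cvg_pairing | exact: cvg_cst].
rewrite -(cvg_lim _ h)//; apply: limr_le; first by apply/cvg_ex; eexists; exact: h.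
near=> n; have Nn : (N <= n)%N by near: n; exists N.
rewrite (le_trans (pairing_tail _ _ Nn))// ler_wpM2l ?opnorm_ge0// lerB//.
by apply: nondecreasing_cvgn_le; [exact: mass_nd | exact: is_cvg_mass].
Unshelve. all: by end_near. Qed.

Lemma rnormal_bound p T : `|rnormal p T| <= opnorm T * tail p 0.
Proof. by have := rnormal_tail p T 0; rewrite seriesEnat /= big_geq// subr0. Qed.

Lemma rnormalL p (a : R) T S : rnormal p (a%:C *: T + S) = a * rnormal p T + rnormal p S.
Proof.
apply: cvg_lim => //.
rewrite (_ : series _ = fun n => a * series (pairing T p) n + series (pairing S p) n).
  apply: cvgD; last exact: is_cvg_pairing.
  by apply: cvgM; [exact: cvg_cst | exact: is_cvg_pairing].
apply/funext => n; rewrite !seriesEnat /= mulr_sumr -big_split.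
by apply: eq_bigr => i _; rewrite /pairing bopDE bopZE riDl riZl.
Qed.

Lemma rnormalD p T S : rnormal p (T + S) = rnormal p T + rnormal p S.
Proof. by have := rnormalL p 1 T S; rewrite scale1r mul1r. Qed.

Lemma rnormal0 p : rnormal p 0 = 0.
Proof. have := rnormalD p 0 0; rewrite addr0 => h; lra. Qed.

Lemma rnormalN p T : rnormal p (- T) = - rnormal p T.
Proof. by have := rnormalD p T (- T); rewrite subrr rnormal0 => h; lra. Qed.

Lemma rnormalB p T S : rnormal p (T - S) = rnormal p T - rnormal p S.
Proof. by rewrite rnormalD rnormalN. Qed.

Lemma ipair_subproof p : sqsum (fun n => 'i *: seq2 p n).
Proof.
rewrite /sqsum; under [X in series X]funext => n do rewrite nrmi.
exact: sqsum2.
Qed.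

(** As < . , i y> = -i < . , y>, the real part for this pair is the imaginary part
    for p. *)
Definition ipair p := mkpair (@sqsum1 p) (@ipair_subproof p).

Lemma normal_functionalsE T p :
  normal_functionals T p = rnormal p T +i* rnormal (ipair p) T.
Proof.
rewrite /normal_functionals; apply: cvg_lim => //.
rewrite (_ : series _ = fun n => (series (pairing T p) n +i*
    series (pairing T (ipair p)) n : R[i]^o)); last first.
  apply/funext => n; elim: n => [|n IH]; first by rewrite !seriesEnat /= !big_geq.
  rewrite !seriesSr IH; apply/eqP; rewrite eq_complex; apply/andP; split; apply/eqP.
    by rewrite ReD.
  rewrite raddfD /=; congr (_ + _); rewrite /pairing /= /ri linearZr_LR /=.
  move: (inner (T (seq1 p n)) (seq2 p n) : R[i]) => -[u v] /=.
  by rewrite mul0r sub0r mulN1r opprK.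
by apply: cvg_complex; exact: is_cvg_pairing.
Qed.

End NormalFunctionals.

(** * The weak-star closure *)

Lemma ptws_eval_continuous (I : Type) (V : ptopologicalType) (i : I) :
  continuous (fun f : {ptws I -> V} => f i).
Proof.
move=> f; have /cvg_sup/(_ i)/cvg_image : (f : {ptws I -> V}) --> f by apply: cvg_id.
move=> h; apply: cvg_trans (h _) => {h}.
  by move=> Q /= [W nbdW <-]; apply: filterS nbdW; exact: preimage_image.
by rewrite eqEsubset; split => y //; exists (fun _ => y).
Qed.

Section WeakStarClosure.
Context {R : realType} {H : hilbertType R}.
Implicit Types (T S : bop H) (A : set (bop H)) (p : @square_summable_pair R H).

Definition near_on (s : seq (@square_summable_pair R H)) (e : R) T S : Prop :=
  forall p, List.In p s -> `|rnormal p (S - T)| < e.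

Lemma rnormal_nbhs p (e : R) T : 0 < e ->
  nbhs (T : @weak_star R H) [set S | `|rnormal p (S - T)| < e].
Proof.
move=> e0.
have cp : continuous (fun S : @weak_star R H => complex.Re (normal_functionals S p)).
  move=> S; have h1 := @initial_continuous _ _ (@normal_functionals R H) S.
  have h2 := @ptws_eval_continuous _ R[i]^o p (normal_functionals S).
  have h3 : (fun x : @weak_star R H => normal_functionals x p) @ S -->
      normal_functionals S p by exact: cvg_comp _ _ h1 h2.
  exact: (cvg_Re h3).
have /cvgrPdist_lt/(_ _ e0) := cp T; apply: filterS => S.
by rewrite !normal_functionalsE /= rnormalB distrC.
Qed.

(** The sets of operators agreeing with T up to e at finitely many pairs form a
    base of neighbourhoods of T. Only real parts occur, since p can be listed
    together with ipair p. *)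
Lemma weak_star_closureP A T : weak_star_closure A T <->
  forall s (e : R), 0 < e -> exists2 S, A S & near_on s e T S.
Proof.
split=> [clT s e e0|h].
  have : nbhs (T : @weak_star R H) [set S | near_on s e T S].
    elim: s => [|p s IH]; first by rewrite (_ : [set S | _] = setT); [exact: filterT | apply/seteqP; split=> // S _ p []].
    apply: (@filterS _ (nbhs (T : @weak_star R H)) _ _ _ _
      (@filterI _ _ _ _ _ (rnormal_nbhs p T e0) IH)) => S [h1 h2] q [<-//|].
    exact: h2.
  by move=> /clT [S [AS hS]]; exists S.
pose D := (seq (@square_summable_pair R H) * R)%type.
pose F := filter_from [set d : D | 0 < d.2]
  (fun d => [set S | A S /\ near_on d.1 d.2 T S]).
have PF : ProperFilter F.
  apply: filter_from_proper; last first.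
    by move=> [s e] /= e0; have [S AS hS] := h s e e0; exists S.
  apply: filter_from_filter; first by exists ([::], 1) => /=.
  move=> [s e] [s' e'] /= e0 e'0; exists (s ++ s', Num.min e e') => /=.
    by rewrite lt_min e0.
  move=> S /= [AS hS]; split; split=> // p ps.
    have /(_ _) := hS p; rewrite lt_min => hp.
    by have /andP[] := hp (proj2 (List.in_app_iff _ _ _) (or_introl ps)).
  have /(_ _) := hS p; rewrite lt_min => hp.
  by have /andP[] := hp (proj2 (List.in_app_iff _ _ _) (or_intror ps)).
have FT : (F : set_system (@weak_star R H)) --> (T : @weak_star R H).
  have FT' : (@normal_functionals R H @ F) --> normal_functionals T.
    apply/cvg_sup => p; apply/cvg_image => //.
      by rewrite eqEsubset; split => y //; exists (fun _ => y).
    have : (fun S => normal_functionals S p) @ F --> normal_functionals T p.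
      apply/cvgrPdist_lt => e e0.
      have e0' : 0 < complex.Re e by move: e0; rewrite ltcE => /andP[].
      have -> : e = (complex.Re e)%:C by rewrite RRe_real// gtr0_real.
      have e2 : 0 < complex.Re e / 2 by rewrite divr_gt0.
      exists ([:: p; ipair p], complex.Re e / 2) => //= S [_ hS].
      have h1 := hS p (or_introl erefl).
      have h2 := hS (ipair p) (or_intror (or_introl erefl)).
      rewrite !normal_functionalsE.
      have -> : (rnormal p T +i* rnormal (ipair p) T : R[i]^o) -
          (rnormal p S +i* rnormal (ipair p) S) =
          - ((rnormal p (S - T))%:C + (rnormal (ipair p) (S - T))%:C * 'i).
        apply/eqP; rewrite eq_complex !rnormalB /=.
        by apply/andP; split; apply/eqP; ring.
      rewrite normrN (le_lt_trans (ler_normD _ _))// normrM !normc_def /= !expr0n /=.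
      rewrite !addr0 add0r expr1n sqrtr1 !sqrtr_sqr mulr1 -rmorphD ltcR.
      by rewrite (splitr (complex.Re e)) ltrD.
    move=> hp B nB; have /= := hp B nB => hB.
    exists [set f | B (f p)] => //.
    rewrite eqEsubset; split => [y [f Bf <-]//|y By].
    by exists (fun _ => y).
  move=> U [/= _ [[W oW <-]]] WT WU.
  exact: (@filterS _ F _ _ _ WU (FT' W (open_nbhs_nbhs (conj oW WT)))).
move=> U /FT [[s e] /= e0 hU]; have [S AS hS] := h s e e0.
by exists S; split=> //; apply: hU.
Qed.

Lemma subset_weak_star_closure A : A `<=` weak_star_closure A.
Proof.
move=> T AT; apply/weak_star_closureP => s e e0; exists T => // p _.
by rewrite subrr rnormal0 normr0.
Qed.

Lemma weak_star_closure_idem A : weak_star_closure (weak_star_closure A) `<=` weak_star_closure A.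
Proof. by move=> T clT; apply: closed_closure. Qed.

End WeakStarClosure.

Section ClosureMaps.
Context {R : realType}.

Lemma sqsum_le (H K : hilbertType R) (x : nat -> H) (y : nat -> K) (C : R) :
  (forall n, nrm (y n) <= C * nrm (x n)) -> sqsum x -> sqsum y.
Proof.
move=> yx sx; apply: (@series_le_cvg _ _ (fun n => C ^+ 2 * nrm (x n) ^+ 2)).
- by move=> n; rewrite exprn_ge0 ?nrm_ge0.
- by move=> n; rewrite mulr_ge0 ?sqr_ge0.
- move=> n; rewrite -exprMn ler_pXn2r ?nnegrE ?nrm_ge0//.
  exact: le_trans (nrm_ge0 _) (yx n).
- have -> : series (fun n => C ^+ 2 * nrm (x n) ^+ 2) =
      C ^+ 2 \*: series (fun n => nrm (x n) ^+ 2).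
    by apply/funext => n; rewrite !seriesEnat /= -scaler_sumr.
  by apply: is_cvgZr.
Qed.

Lemma eq_rnormal (H K : hilbertType R) (p : @square_summable_pair R H)
    (q : @square_summable_pair R K) (T : bop H) (S : bop K) :
  (forall n, pairing T p n = pairing S q n) -> rnormal p T = rnormal q S.
Proof. by move=> /funext e; rewrite /rnormal e. Qed.

(** Applies to the maps that pull normal functionals back to normal functionals:
    multiplications, the adjunction, translations and slices. *)
Lemma weak_star_closure_map (H K : hilbertType R) (A : set (bop H)) (B : set (bop K))
    (phi : bop H -> bop K) :
  (forall p, exists q, forall S T, rnormal p (phi S - phi T) = rnormal q (S - T)) ->
  (forall S, A S -> B (phi S)) ->
  forall T, weak_star_closure A T -> weak_star_closure B (phi T).
Proof.
move=> /choice[q hq] AB T clT; apply/weak_star_closureP => s e e0.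
have [S AS hS] := (weak_star_closureP A T).1 clT (map q s) e e0.
exists (phi S); first exact: AB.
by move=> p ps; rewrite hq; apply: hS; apply: List.in_map.
Qed.

End ClosureMaps.

(** * Star algebras of operators *)

Section StarAlgebras.
Context {R : realType} {H : hilbertType R}.
Implicit Types (A : set (bop H)) (S T U : bop H).

Definition linear_set A : Prop := forall (a : R[i]) S T, A S -> A T -> A (a *: S + T).

(** The identity of H need not belong to A: the image of an embedding has its own
    unit. *)
Definition star_algebra A : Prop :=
  [/\ A 0, linear_set A,
      forall S T, A S -> A T -> A (bop_comp S T) &
      forall T, A T -> A (adj T)].

Definition norm_closed A : Prop := forall T,
  (forall e : R, 0 < e -> exists2 S, A S & opnorm (S - T) < e) -> A T.

Lemma star_algebraZ A a T : star_algebra A -> A T -> A (a *: T).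
Proof. by case=> A0 AL _ _ AT; rewrite -[_ *: _]addr0; apply: AL. Qed.

Lemma star_algebraD A S T : star_algebra A -> A S -> A T -> A (S + T).
Proof. by case=> A0 AL _ _ AS AT; rewrite -(scale1r S); apply: AL. Qed.

Lemma star_algebraN A T : star_algebra A -> A T -> A (- T).
Proof. by move=> hA AT; rewrite -scaleN1r; apply: star_algebraZ. Qed.

Lemma star_algebraB A S T : star_algebra A -> A S -> A T -> A (S - T).
Proof. by move=> hA AS AT; apply: star_algebraD => //; apply: star_algebraN. Qed.

Lemma star_algebra_sum A I (s : seq I) (P : pred I) (F : I -> bop H) :
  star_algebra A -> (forall i, P i -> A (F i)) -> A (\sum_(i <- s | P i) F i).
Proof.
move=> hA AF; apply: big_ind => //; first by case: hA.
by move=> S T; apply: star_algebraD.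
Qed.

Lemma bop_compDr S T U : bop_comp S (T + U) = bop_comp S T + bop_comp S U.
Proof. by apply: bopP => x; exact: bopD. Qed.
Lemma bop_compDl S T U : bop_comp (S + T) U = bop_comp S U + bop_comp T U.
Proof. exact: bopP. Qed.
Lemma bop_compZl a S T : bop_comp (a *: S) T = a *: bop_comp S T.
Proof. exact: bopP. Qed.
Lemma bop_compZr a S T : bop_comp S (a *: T) = a *: bop_comp S T.
Proof. by apply: bopP => x; exact: bopZ. Qed.
Lemma bop_compNl S T : bop_comp (- S) T = - bop_comp S T.
Proof. by rewrite -scaleN1r bop_compZl scaleN1r. Qed.
Lemma bop_compNr S T : bop_comp S (- T) = - bop_comp S T.
Proof. by rewrite -scaleN1r bop_compZr scaleN1r. Qed.
Lemma bop_compBr S T U : bop_comp S (T - U) = bop_comp S T - bop_comp S U.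
Proof. by rewrite bop_compDr bop_compNr. Qed.
Lemma bop_compBl S T U : bop_comp (S - T) U = bop_comp S U - bop_comp T U.
Proof. by rewrite bop_compDl bop_compNl. Qed.
Lemma bop_compA S T U : bop_comp S (bop_comp T U) = bop_comp (bop_comp S T) U.
Proof. exact: bopP. Qed.
Lemma bop_comp1l T : bop_comp (bop_id H) T = T. Proof. exact: bopP. Qed.
Lemma bop_comp1r T : bop_comp T (bop_id H) = T. Proof. exact: bopP. Qed.

Lemma sqsum_bop U (x : nat -> H) : sqsum x -> sqsum (U \o x).
Proof. by apply: (@sqsum_le _ _ _ _ _ (opnorm U)) => n; exact: nrm_opnorm. Qed.

Lemma sqsumZ (a : R[i]) (x : nat -> H) : sqsum x -> sqsum (fun n => a *: x n).
Proof. by apply: (@sqsum_le _ _ _ _ _ (complex.Re `|a|)) => n; rewrite nrmZ. Qed.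

Lemma rnormal_compl p U : exists q, forall S T,
  rnormal p (bop_comp U S - bop_comp U T) = rnormal q (S - T).
Proof.
exists (mkpair (@sqsum1 _ _ p) (sqsum_bop (U := adj U) (@sqsum2 _ _ p))) => S T.
by rewrite -bop_compBr; apply: eq_rnormal => n; rewrite /pairing /= ri_adj.
Qed.

Lemma rnormal_compr p U : exists q, forall S T,
  rnormal p (bop_comp S U - bop_comp T U) = rnormal q (S - T).
Proof.
exists (mkpair (sqsum_bop (U := U) (@sqsum1 _ _ p)) (@sqsum2 _ _ p)) => S T.
by rewrite -bop_compBl; apply: eq_rnormal.
Qed.

Lemma rnormal_adj p : exists q, forall S T,
  rnormal p (adj S - adj T) = rnormal q (S - T).
Proof.
exists (mkpair (@sqsum2 _ _ p) (@sqsum1 _ _ p)) => S T.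
apply: eq_rnormal => n.
change (ri (adj S (seq1 p n) - adj T (seq1 p n)) (seq2 p n) =
  ri (S (seq2 p n) - T (seq2 p n)) (seq1 p n)).
rewrite !riBl !ri_adjl.
by rewrite !(ri_sym (seq1 p n)).
Qed.

Lemma rnormal_scale p (a : R[i]) : exists q, forall S T,
  rnormal p (a *: S - a *: T) = rnormal q (S - T).
Proof.
exists (mkpair (@sqsum1 _ _ p) (sqsumZ (a := (a^*)%C) (@sqsum2 _ _ p))) => S T.
by rewrite -scalerBr; apply: eq_rnormal => n; exact: riZ.
Qed.

Lemma norm_closed_weak_star_closure A : norm_closed (weak_star_closure A).
Proof.
move=> T hT; apply: weak_star_closure_idem; apply/weak_star_closureP => s e e0.
have [C C0 hC] : exists2 C : R, 0 < C & forall p, List.In p s -> tail p 0 <= C.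
  elim: s => [|p s [C C0 IH]]; first by exists 1.
  exists (C + tail p 0); first by rewrite ltr_wpDr ?tail_ge0.
  by move=> q [<-|/IH h]; [rewrite lerDr ltW | rewrite (le_trans h)// lerDl tail_ge0].
have [S clS hS] := hT (e / C) (divr_gt0 e0 C0).
exists S => // p ps; rewrite (le_lt_trans (rnormal_bound _ _))//.
rewrite (le_lt_trans (ler_wpM2l (opnorm_ge0 _) (hC p ps)))//.
by rewrite -ltr_pdivlMr.
Qed.

(** Multiplication is only separately weak-star continuous; each of the two
    operands is moved to the closure in turn, and the closure is idempotent. *)
Lemma star_algebra_weak_star_closure A :
  star_algebra A -> star_algebra (weak_star_closure A).
Proof.
move=> hA; have [A0 AL AM AS] := hA; split.
- exact: subset_weak_star_closure.
- move=> a S T clS clT; apply: weak_star_closure_idem.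
  apply: (weak_star_closure_map (A := A) (phi := fun S => a *: S + T)) clS => [p|S' AS'].
    have [q hq] := rnormal_scale p a; exists q => S1 T1.
    by rewrite -hq; congr rnormal; rewrite opprD addrACA subrr addr0.
  apply: (weak_star_closure_map (phi := fun T => a *: S' + T)) clT => [p|T' AT'].
    by exists p => S1 T1; congr rnormal; rewrite opprD addrACA subrr add0r.
  exact: AL.
- move=> S T clS clT; apply: weak_star_closure_idem.
  apply: (weak_star_closure_map (A := A) (phi := fun S => bop_comp S T)) clS => [p|S' AS'].
    exact: rnormal_compr.
  apply: (weak_star_closure_map (phi := fun T => bop_comp S' T)) clT => [p|T' AT'].
    exact: rnormal_compl.
  exact: AM.
- by move=> T; apply: weak_star_closure_map => // p; exact: rnormal_adj.
Qed.

Lemma von_neumann_star_algebra A : von_neumann_algebra A ->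
  [/\ A (bop_id H), star_algebra A & norm_closed A].
Proof.
case=> A1 AL AM AS clA; split=> //; last first.
  by rewrite -clA; exact: norm_closed_weak_star_closure.
split=> //.
  have <- : (-1) *: bop_id H + bop_id H = 0 by rewrite scaleN1r addNr.
  exact: AL.
by move=> T /AS; apply; exact: adj_adjoint.
Qed.

End StarAlgebras.

(** * Square roots and inverses in norm-closed star algebras *)

Section FixedPoints.
Context {R : realType} {H : hilbertType R}.
Implicit Types (A : set (bop H)) (S T U : bop H).

Lemma bop_limit (u : nat -> bop H) (C r : R) : 0 <= r < 1 ->
  (forall n, opnorm (u n.+1 - u n) <= C * r ^+ n) ->
  exists T, forall n, opnorm (u n - T) <= C / (1 - r) * r ^+ n.
Proof.
move=> r01 hu; have /andP[r0 r1] := r01.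
have C0 : 0 <= C by have := le_trans (opnorm_ge0 _) (hu 0%N); rewrite expr0 mulr1.
pose D := C / (1 - r).
have D0 : 0 <= D by rewrite divr_ge0 ?subr_ge0 ?(ltW r1).
have ex x : exists l, forall n, nrm (u n x - l) <= D * nrm x * r ^+ n.
  have [|l hl] := @geometric_limit _ _ (fun n => u n x) (C * nrm x) r r01.
    by move=> n; rewrite mulrAC -bopBE; exact: nrm_bop_le.
  by exists l => n; rewrite (le_trans (hl n))// /D (mulrAC C).
have [f hf] := choice ex.
have [||T Tf] := @make_bop _ _ f (opnorm (u 0%N) + D).
- move=> a x y; apply/eqP; rewrite -subr_eq0; apply/eqP/nrm0_eq0.
  apply/le_anti; rewrite nrm_ge0 andbT.
  apply: (@le0_geometric _ r (D * nrm (a *: x + y) + (complex.Re `|a| * (D * nrm x) + D * nrm y)) _ r01) => n.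
  have -> : f (a *: x + y) - (a *: f x + f y) =
      - (u n (a *: x + y) - f (a *: x + y)) + (a *: (u n x - f x) + (u n y - f y)).
    by rewrite bop_lin scalerBr opprB [X in _ = _ + X]addrACA [RHS]addrA subrK -opprD.
  rewrite (le_trans (nrmD _ _))// nrmN !mulrDl lerD ?hf//.
  rewrite (le_trans (nrmD _ _))// lerD ?hf// nrmZ -(mulrA (complex.Re _)) ler_wpM2l ?hf//.
  by rewrite normc_def sqrtr_ge0.
- move=> x; rewrite -(subKr (u 0%N x) (f x)) (le_trans (nrmD _ _))// nrmN mulrDl.
  by rewrite lerD ?nrm_opnorm// (le_trans (hf x 0%N))// expr0 mulr1.
exists T => n; apply: opnorm_le => [|x]; first by rewrite mulr_ge0// exprn_ge0.
by rewrite bopBE Tf (le_trans (hf x n))// mulrAC.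
Qed.

Lemma contraction_fixpoint A (Th : bop H -> bop H) (r : R) S0 : 0 <= r < 1 ->
  norm_closed A -> A S0 -> (forall S, A S -> A (Th S)) ->
  (forall S T, A S -> A T -> opnorm (Th S - Th T) <= r * opnorm (S - T)) ->
  exists2 T, A T & Th T = T.
Proof.
move=> r01 clA AS0 ATh hTh; have /andP[r0 r1] := r01.
pose u n := iter n Th S0.
have Au n : A (u n) by elim: n => //= n /ATh.
pose C := opnorm (u 1%N - u 0%N).
have hu n : opnorm (u n.+1 - u n) <= C * r ^+ n.
  elim: n => [|n IH]; first by rewrite expr0 mulr1.
  apply: le_trans (hTh (u n.+1) (u n) (Au _) (Au _)) _; rewrite exprS mulrCA.
  by rewrite ler_wpM2l.
have [T hT] := bop_limit r01 hu; set D := C / (1 - r) in hT.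
have AT : A T.
  apply: clA => e e0; apply: contrapT => hN.
  have : e <= 0.
    apply: (le0_geometric (C := D) r01) => n; rewrite leNgt; apply/negP => he.
    by apply: hN; exists (u n) => //; exact: le_lt_trans (hT n) he.
  by rewrite leNgt e0.
exists T => //; apply/eqP; rewrite -subr_eq0; apply/eqP/opnorm0_eq0.
apply: (le0_geometric (C := r * D + D * r) r01) => n.
rewrite -(subrKA (u n.+1)) (le_trans (opnormD _ _))// mulrDl lerD//.
  apply: le_trans (hTh T (u n) AT (Au _)) _.
  by rewrite -mulrA ler_wpM2l// opnormB.
by rewrite (le_trans (hT _))// exprS mulrA.
Qed.

(** The equation says that (1 - b)^2 = 1 - h, without mentioning a unit. Its
    solution is the fixed point of b |-> (h + b^2) / 2 on the self-adjoint part
    of the ball of radius 1 - d, where this map has Lipschitz constant 1 - d. *)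
Lemma self_adjoint_sqrt A (h : bop H) (d : R) : 0 < d <= 1 ->
  star_algebra A -> norm_closed A -> A h -> adj h = h -> opnorm h <= 1 - d ^+ 2 ->
  exists b, [/\ A b, adj b = b & h + bop_comp b b = b + b].
Proof.
move=> /andP[d0 d1] hA clA Ah hh hn.
pose B := [set b | [/\ A b, adj b = b & opnorm b <= 1 - d]].
have clB : norm_closed B.
  move=> T hT; split.
  - by apply: clA => e e0; have [S [AS _ _] hS] := hT e e0; exists S.
  - apply/eqP; rewrite -subr_eq0; apply/eqP/opnorm0_eq0.
    apply/ler_addgt0Pr => e e0; rewrite add0r.
    have [S [_ hS _] ST] := hT (e / 2) (divr_gt0 e0 (ltr0Sn _ _)).
    rewrite -(subrKA S) (le_trans (opnormD _ _))// (splitr e) lerD ?(ltW ST)//.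
    have -> : adj T - S = adj (T - S).
      by rewrite adjB hS.
    by rewrite (le_trans (opnorm_adj _))// opnormB ltW.
  - apply/ler_addgt0Pr => e e0; have [S [_ _ hS] ST] := hT e e0.
    rewrite -(subrKC S T) (le_trans (opnormD _ _))// lerD//.
    by rewrite opnormB ltW.
pose Th b := (2^-1)%:C *: (h + bop_comp b b).
have [_ _ AM _] := hA.
have d01 : 0 <= 1 - d < 1 by rewrite subr_ge0 d1 /= ltrBlDr ltrDl.
have [|||b [Ab bb _] Thb] := @contraction_fixpoint B Th (1 - d) 0 d01 clB.
- split; first by case: hA.
    by rewrite adj0.
  by rewrite opnorm_0 subr_ge0.
- move=> b [Ab bb nb]; split.
  + by apply: (star_algebraZ _ hA); apply: (star_algebraD hA Ah); apply: AM.
  + by rewrite adjZr adjD hh adj_comp bb.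
  + rewrite (le_trans (opnormZr _ _))// (@ger0_norm _ 2^-1)//.
    have := opnormD h (bop_comp b b); have := opnorm_comp b b; have := opnorm_ge0 b.
    move=> b0 h1 h2; have : opnorm b * opnorm b <= (1 - d) * (1 - d) by rewrite ler_pM.
    lra.
- move=> b c [Ab bb nb] [Ac cc nc].
  have -> : Th b - Th c = (2^-1)%:C *: (bop_comp b (b - c) + bop_comp (b - c) c).
    rewrite -scalerBr opprD addrACA subrr add0r; congr (_ *: _).
    by rewrite bop_compBr bop_compBl addrA subrK.
  rewrite (le_trans (opnormZr _ _))// (@ger0_norm _ 2^-1)//.
  have h0 := opnormD (bop_comp b (b - c)) (bop_comp (b - c) c).
  have h1 := opnorm_comp b (b - c); have h2 := opnorm_comp (b - c) c.
  have n0 := opnorm_ge0 (b - c).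
  have : opnorm b * opnorm (b - c) <= (1 - d) * opnorm (b - c) by rewrite ler_wpM2r.
  have : opnorm (b - c) * opnorm c <= opnorm (b - c) * (1 - d) by rewrite ler_wpM2l.
  lra.
exists b; split => //; rewrite -{3 4}Thb /Th -scalerDl -rmorphD /=.
have -> : 2^-1 + 2^-1 = 1 :> R by field.
by rewrite scale1r.
Qed.

(** With B > opnorm c, the choice t = e / B^2 in |x - t c x|^2 gives the factor
    1 - (e / B)^2, which is at most (1 - d^2)^2 for d = e / (2 B). The bound has
    this shape because a square root of t c is sought. *)
Lemma coercive_contraction (c : bop H) (e : R) : 0 < e ->
  (forall x, e * nrm x ^+ 2 <= ri (c x) x) ->
  exists t d : R, [/\ 0 < t, 0 < d <= 1 & opnorm (bop_id H - t%:C *: c) <= 1 - d ^+ 2].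
Proof.
move=> e0 hc; pose B := opnorm c + e.
have B0 : 0 < B by rewrite ltr_wpDl ?opnorm_ge0.
pose d := e / (2 * B).
have d0 : 0 < d by rewrite divr_gt0 ?mulr_gt0.
have d1 : d <= 2^-1.
  rewrite /d ler_pdivrMr ?mulr_gt0//.
  have -> : 2^-1 * (2 * B) = B by field.
  by rewrite lerDr opnorm_ge0.
have d2 : 0 <= 1 - d ^+ 2 by rewrite subr_ge0; nra.
exists (e / B ^+ 2), d; split; first by rewrite divr_gt0 ?exprn_gt0.
  by rewrite d0 /=; lra.
apply: opnorm_le => // x; set t := e / B ^+ 2.
rewrite -(@ler_pXn2r _ 2) ?nnegrE ?nrm_ge0//; last by rewrite mulr_ge0 ?nrm_ge0.
rewrite exprMn sqr_nrm bopBE bopZE riBl !riBr !riZl !riZr /= -!sqr_nrm (ri_sym x).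
have cx : nrm (c x) ^+ 2 <= B ^+ 2 * nrm x ^+ 2.
  rewrite -exprMn ler_pXn2r ?nnegrE ?nrm_ge0 ?mulr_ge0 ?nrm_ge0 ?(ltW B0)//.
  by apply: nrm_bop_le; rewrite lerDl ltW.
have t0 : 0 < t by rewrite divr_gt0 ?exprn_gt0.
have te : t * e = 4 * d ^+ 2 by rewrite /t /d; field; rewrite lt0r_neq0.
have tB : t * B ^+ 2 = e by rewrite /t divfK// expf_neq0// lt0r_neq0.
have h1 : t * (e * nrm x ^+ 2) <= t * ri (c x) x by rewrite ler_wpM2l ?(ltW t0).
have h2 : t * (t * nrm (c x) ^+ 2) <= t * (t * (B ^+ 2 * nrm x ^+ 2)).
  by rewrite !ler_wpM2l ?(ltW t0).
have h3 : t * (t * (B ^+ 2 * nrm x ^+ 2)) = 4 * d ^+ 2 * nrm x ^+ 2.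
  by rewrite -te -tB; ring.
have h4 : t * (e * nrm x ^+ 2) = 4 * d ^+ 2 * nrm x ^+ 2 by rewrite mulrA te.
have x0 : 0 <= nrm x ^+ 2 by rewrite exprn_ge0 ?nrm_ge0.
have h5 : (1 - 4 * d ^+ 2) * nrm x ^+ 2 <= (1 - d ^+ 2) ^+ 2 * nrm x ^+ 2.
  by rewrite ler_wpM2r//; nra.
lra.
Qed.

(** The inverse is the fixed point of d |-> t + (1 - t c) d, that is, the sum of
    the Neumann series of t c, multiplied by t. *)
Lemma coercive_inverse A (c : bop H) (e : R) : 0 < e ->
  A (bop_id H) -> star_algebra A -> norm_closed A -> A c -> adj c = c ->
  (forall x, e * nrm x ^+ 2 <= ri (c x) x) ->
  exists d, [/\ A d, adj d = d, bop_comp c d = bop_id H & bop_comp d c = bop_id H].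
Proof.
move=> e0 A1 hA clA Ac cc hc; have [t [r [t0 /andP[r0 r1] hr]]] := coercive_contraction e0 hc.
set h := bop_id H - t%:C *: c in hr.
have Ah : A h by apply: star_algebraB => //; apply: star_algebraZ.
have [A0 _ AM AS] := hA.
have r01 : 0 <= 1 - r ^+ 2 < 1.
  by rewrite subr_ge0 exprn_ile1 ?(ltW r0)//= ltrBlDr ltrDl exprn_gt0.
have [|||d Ad hd] := @contraction_fixpoint A (fun d => t%:C *: bop_id H + bop_comp h d)
  _ 0 r01 clA.
- by [].
- by move=> S AS'; apply: star_algebraD => //; [apply: star_algebraZ | apply: AM].
- move=> S T _ _; rewrite opprD addrACA subrr add0r -bop_compBr.
  by rewrite (le_trans (opnorm_comp _ _))// ler_wpM2r ?opnorm_ge0.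
have cd : bop_comp c d = bop_id H.
  have : t%:C *: bop_comp c d = t%:C *: bop_id H.
    rewrite -[in RHS](addrK (bop_comp h d) (_ *: _)) hd /h bop_compBl bop_comp1l bop_compZl.
    by rewrite subKr.
  move/(congr1 (fun T => (t^-1)%:C *: T)); rewrite !scalerA -rmorphM /= mulVf ?lt0r_neq0//.
  by rewrite !scale1r.
have dc : bop_comp (adj d) c = bop_id H by rewrite -cc -adj_comp cd adj_id.
have dd : adj d = d by rewrite -[LHS]bop_comp1r -cd bop_compA dc bop_comp1l.
by exists d; split=> //; rewrite -dd.
Qed.

End FixedPoints.

(** * Star homomorphisms *)

(** The square of u - b when u is a unit for b and b^2 = - h + 2 b. *)
Lemma square_identity (V : zmodType) (u b h : V) :
  u - b - (b - (- h + (b + b))) = u - h.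
Proof. by rewrite opprB addrACA -opprD addrA addrK. Qed.

Section StarHom.
Context {R : realType} {H K : hilbertType R}.
Variables (A : set (bop H)) (f : bop H -> bop K).

Definition star_hom : Prop :=
  [/\ forall (a : R[i]) S T, A S -> A T -> f (a *: S + T) = a *: f S + f T,
      forall S T, A S -> A T -> f (bop_comp S T) = bop_comp (f S) (f T) &
      forall S, A S -> f (adj S) = adj (f S)].

Hypotheses (hA : star_algebra A) (clA : norm_closed A) (hf : star_hom).

Lemma star_homD S T : A S -> A T -> f (S + T) = f S + f T.
Proof. by case: hf => fL _ _ AS AT; have := fL 1 S T AS AT; rewrite !scale1r. Qed.

Lemma star_hom0 : f 0 = 0.
Proof.
have A0 : A 0 by case: hA.
have /esym := star_homD A0 A0; rewrite addr0 => /(canRL (addrK _)).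
by rewrite subrr.
Qed.

Lemma star_homZ a S : A S -> f (a *: S) = a *: f S.
Proof.
have A0 : A 0 by case: hA.
by case: hf => fL _ _ AS; have := fL a S 0 AS A0; rewrite star_hom0 !addr0.
Qed.

Lemma star_homB S T : A S -> A T -> f (S - T) = f S - f T.
Proof.
move=> AS AT; rewrite star_homD//; last exact: star_algebraN.
by rewrite -scaleN1r star_homZ// scaleN1r.
Qed.

Lemma star_hom_sum I (s : seq I) (P : pred I) (F : I -> bop H) :
  (forall i, P i -> A (F i)) ->
  f (\sum_(i <- s | P i) F i) = \sum_(i <- s | P i) f (F i).
Proof.
move=> AF; suff [_ //] : A (\sum_(i <- s | P i) F i) /\
   f (\sum_(i <- s | P i) F i) = \sum_(i <- s | P i) f (F i).
apply: (big_ind2 (fun S T => A S /\ f S = T)).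
- by split; [case: hA | exact: star_hom0].
- move=> S S' T T' [AS <-] [AT <-].
  by split; [exact: star_algebraD | rewrite star_homD].
- by move=> i /AF.
Qed.

(** If the norm of a is less than 1, then e - a^* a is the square of e - b for a
    self-adjoint b in A, so its image is positive, which means that
    |f a y|^2 <= <f e y, y> <= |y|^2. The algebra A has to be norm closed for b to
    belong to it. *)
Lemma star_hom_contractive e : A e -> adj e = e ->
  (forall T, A T -> bop_comp e T = T) -> (forall T, A T -> bop_comp T e = T) ->
  forall T, A T -> opnorm (f T) <= opnorm T.
Proof.
move=> Ae ee eT Te T AT; have [A0 AL AM AS] := hA; have [fL fM fS] := hf.
have fe y : ri (f e y) y <= nrm y ^+ 2.
  have h : nrm (f e y) ^+ 2 = ri (f e y) y.
    by rewrite sqr_nrm ri_adj -(fS _ Ae) ee -[f e (f e y)]/(bop_comp (f e) (f e) y)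
      -fM// eT// ri_sym.
  have := cauchy_schwarz (f e y) y; rewrite -h => h1.
  have h2 := nrm_ge0 y; have h3 := nrm_ge0 (f e y).
  have [h4|h4] := leP (nrm (f e y)) (nrm y); nra.
have main a : A a -> opnorm a < 1 -> forall y, nrm (f a y) <= nrm y.
  move=> Aa a1 y; have a0 := opnorm_ge0 a.
  pose q := opnorm a * opnorm a.
  have q0 : 0 <= q by rewrite mulr_ge0.
  have q1 : q < 1 by rewrite /q; nra.
  pose h := bop_comp (adj a) a.
  have Ah : A h by apply: AM => //; apply: AS.
  have [|||b [Ab bb hb]] := @self_adjoint_sqrt _ _ A h (1 - q) _ hA clA Ah.
  - by rewrite subr_gt0 q1 /= gerBl.
  - by rewrite /h adj_comp adjK.
  - rewrite (le_trans (opnorm_comp _ _))// (@le_trans _ _ q)//.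
      by rewrite /q ler_wpM2r ?opnorm_adj.
    nra.
  have Aeb : A (e - b) by exact: star_algebraB.
  have eb : bop_comp (e - b) (e - b) = e - h.
    rewrite bop_compBr !bop_compBl eT// eT// Te// -[bop_comp b b](addKr h) hb.
    exact: square_identity.
  have fh : ri (f h y) y = nrm (f a y) ^+ 2.
    rewrite sqr_nrm /h fM//; last exact: AS.
    by rewrite fS//= ri_adjl.
  have feb : ri (f (e - h) y) y = nrm (f (e - b) y) ^+ 2.
    rewrite -eb fM// sqr_nrm /= ri_adj -fS//; congr ri; congr (f _ _).
    by rewrite adjB ee bb.
  move: feb; rewrite star_homB// bopBE riBl fh => feb.
  rewrite -(@ler_pXn2r _ 2) ?nnegrE ?nrm_ge0//.
  have := fe y; have := sqr_ge0 (nrm (f (e - b) y)); lra.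
apply: opnorm_le => [|y]; first exact: opnorm_ge0.
have T0 := opnorm_ge0 T.
suff hs s : opnorm T < s -> nrm (f T y) <= s * nrm y.
  apply/ler_addgt0Pr => d d0.
  have y1 : 0 < nrm y + 1 by rewrite ltr_wpDl ?nrm_ge0.
  have := hs (opnorm T + d / (nrm y + 1)); rewrite ltrDl divr_gt0// => /(_ isT) h.
  rewrite (le_trans h)// mulrDl lerD2l mulrAC ler_pdivrMr// ler_wpM2l ?(ltW d0)//.
  by rewrite lerDl.
move=> Ts; have s0 : 0 < s by exact: le_lt_trans T0 Ts.
have := main ((s^-1)%:C *: T) (star_algebraZ _ hA AT).
rewrite star_homZ// => h; have {}h := h _ y.
have -> : f T y = s%:C *: ((s^-1)%:C *: f T) y.
  by rewrite bopZE scalerA -rmorphM /= mulfV ?scale1r// lt0r_neq0.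
rewrite nrmZr gtr0_norm// ler_pM2l// h//.
rewrite (le_lt_trans (opnormZr _ _))// ger0_norm ?invr_ge0 ?(ltW s0)//.
by rewrite mulrC ltr_pdivrMr// mul1r.
Qed.

(** A positive multiple of c is the square of a self-adjoint element of A. *)
Lemma star_hom_coercive_ge0 c (e : R) : A (bop_id H) -> 0 < e ->
  A c -> adj c = c -> (forall x, e * nrm x ^+ 2 <= ri (c x) x) ->
  forall y, 0 <= ri (f c y) y.
Proof.
move=> A1 e0 Ac cc hc y; have [A0 AL AM AS] := hA; have [fL fM fS] := hf.
have [t [d [t0 hd hr]]] := coercive_contraction e0 hc.
set h := bop_id H - t%:C *: c in hr.
have Ah : A h by apply: star_algebraB => //; apply: star_algebraZ.
have hh : adj h = h.
  by rewrite /h adjB adj_id adjZr cc.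
have [b [Ab bb hb]] := self_adjoint_sqrt hd hA clA Ah hh hr.
have Aeb : A (bop_id H - b) by exact: star_algebraB.
have eb : bop_comp (bop_id H - b) (bop_id H - b) = t%:C *: c.
  rewrite bop_compBr !bop_compBl !bop_comp1l bop_comp1r -[bop_comp b b](addKr h) hb.
  by rewrite square_identity /h subKr.
have h1 : t * ri (f c y) y = nrm (f (bop_id H - b) y) ^+ 2.
  rewrite -riZl -bopZE -star_homZ// -eb fM// sqr_nrm /= ri_adj -fS//.
  congr ri; congr (f _ _).
  by rewrite adjB adj_id bb.
by rewrite -(pmulr_rge0 _ t0) h1 exprn_ge0 ?nrm_ge0.
Qed.

End StarHom.

(** * Extension of positive functionals *)

Section PositiveExtension.
Context {R : realType} {X : Type}.
Implicit Types (v w u b : X -> R) (G E : set ((X -> R) * R)).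

Definition graph_subspace G : Prop :=
  G (fun _ => 0, 0) /\ forall k v r w s, G (v, r) -> G (w, s) ->
    G (fun x => k * v x + w x, k * r + s).

Definition graph_positive G : Prop :=
  forall v r, G (v, r) -> (forall x, 0 <= v x) -> 0 <= r.

Definition dominated G v : Prop :=
  exists b r, G (b, r) /\ forall x, `|v x| <= b x.

Lemma graph_scale G k v r : graph_subspace G -> G (v, r) ->
  G (fun x => k * v x, k * r).
Proof.
case=> G0 GL Gv; have := GL k _ _ _ _ Gv G0; rewrite addr0.
by under eq_fun do rewrite addr0.
Qed.

Lemma graph_sub G v r w s : graph_subspace G -> G (v, r) -> G (w, s) ->
  G (fun x => v x - w x, r - s).
Proof.
move=> [G0 GL] Gv Gw; have := GL (-1) _ _ _ _ Gw Gv.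
by rewrite mulN1r addrC; under eq_fun do rewrite mulN1r addrC.
Qed.

Lemma graph_add G v r w s : graph_subspace G -> G (v, r) -> G (w, s) ->
  G (fun x => v x + w x, r + s).
Proof.
move=> [G0 GL] Gv Gw; have := GL 1 _ _ _ _ Gv Gw.
by rewrite mul1r; under eq_fun do rewrite mul1r.
Qed.

Lemma graph_functional G v r s : graph_subspace G -> graph_positive G ->
  G (v, r) -> G (v, s) -> r = s.
Proof.
move=> GS GP Gr Gs; apply/le_anti; apply/andP; split; rewrite -subr_ge0.
  by apply: (GP _ _ (graph_sub GS Gs Gr)) => x; rewrite subrr.
by apply: (GP _ _ (graph_sub GS Gr Gs)) => x; rewrite subrr.
Qed.

Definition extend_graph E (v0 : X -> R) (a : R) : set ((X -> R) * R) :=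
  [set p | exists k u r, E (u, r) /\ p = (fun x => k * v0 x + u x, k * a + r)].

Lemma extend_graph_subset E v0 a : E `<=` extend_graph E v0 a.
Proof.
move=> [u r] Eu; exists 0, u, r; split=> //; rewrite mul0r add0r; congr pair.
by apply/funext => x; rewrite mul0r add0r.
Qed.

Lemma extend_graph_subspace E v0 a : graph_subspace E ->
  graph_subspace (extend_graph E v0 a).
Proof.
move=> ES; split; first by apply: extend_graph_subset; case: ES.
move=> k _ _ _ _ [k1 [u1 [r1 [E1 [-> ->]]]]] [k2 [u2 [r2 [E2 [-> ->]]]]].
exists (k * k1 + k2), (fun x => k * u1 x + u2 x), (k * r1 + r2); split.
  exact: ES.2.
congr pair; last by ring.
by apply/funext => x; ring.
Qed.

(** The value given to v0 is the supremum of those of the functions below v0. *)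
Lemma extend_graph_positive E v0 : graph_subspace E -> graph_positive E ->
  dominated E v0 -> exists a, graph_positive (extend_graph E v0 a).
Proof.
move=> ES EP [b [rb [Eb hb]]].
pose L := [set r | exists2 u, E (u, r) & forall x, u x <= v0 x].
have supL : has_sup L.
  split.
    exists (-1 * rb), (fun x => -1 * b x); first exact: graph_scale.
    by move=> x; have := hb x; rewrite ler_norml mulN1r => /andP[].
  exists rb => r [u Eu uv]; rewrite -subr_ge0.
  apply: (EP _ _ (graph_sub ES Eb Eu)) => x; rewrite subr_ge0.
  by rewrite (le_trans (uv x))// (le_trans (ler_norm _)).
exists (sup L) => _ _ [k [u [r [Eu [-> ->]]]]] pos.
have [k0|k0|k0] := ltrgtP k 0.
- rewrite -(ler_nM2l (x := k^-1)) ?invr_lt0// mulr0 mulrDr mulKf ?lt_eqF//.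
  rewrite -(opprK (_ * r)) subr_le0; apply: ge_sup; first exact: supL.1.
  move=> s [w Ew wv]; rewrite -subr_ge0 -mulNr.
  apply: (EP _ _ (graph_sub ES (graph_scale (- k^-1) ES Eu) Ew)) => x.
  have h1 := wv x; have h2 := pos x.
  have : v0 x <= - k^-1 * u x.
    rewrite mulNr -(ler_nM2l k0) mulrN mulVKf ?lt_eqF//; lra.
  by lra.
- rewrite -(ler_pM2l (x := k^-1)) ?invr_gt0// mulr0 mulrDr mulKf ?gt_eqF//.
  rewrite -(opprK (_ * r)) subr_ge0; apply: sup_upper_bound => //.
  exists (fun x => - k^-1 * u x); first by rewrite -mulNr; exact: graph_scale.
  move=> x; rewrite mulNr -(ler_pM2l k0) mulrN mulVKf ?gt_eqF//.
  by have := pos x; lra.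
- rewrite k0 mul0r add0r; apply: (EP _ _ Eu) => x.
  by have := pos x; rewrite k0 mul0r add0r.
Qed.

(** This is the extension theorem of M. Riesz, a form of the Hahn-Banach theorem,
    for a functional given by its graph: the graph is that of a function because
    the functional is positive. A maximal positive graph is provided by Zorn's
    lemma. *)
Theorem positive_extension G : graph_subspace G -> graph_positive G ->
  exists g : (X -> R) -> R,
  [/\ forall v r, G (v, r) -> g v = r,
      forall k v w, dominated G v -> dominated G w ->
        g (fun x => k * v x + w x) = k * g v + g w &
      forall v, dominated G v -> (forall x, 0 <= v x) -> 0 <= g v].
Proof.
move=> GS GP.
pose P (A : set ((X -> R) * R)) := graph_subspace (G `|` A) /\ graph_positive (G `|` A).
have [F FP Ftot|A [[ES EP] maxA]] := @Zorn_bigcup _ P.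
  have both p q : (G `|` \bigcup_(A in F) A) p -> (G `|` \bigcup_(A in F) A) q ->
      exists2 A, (A = set0 \/ F A) & (G `|` A) p /\ (G `|` A) q.
    move=> [Gp|[A FA Ap]] [Gq|[B FB Bq]].
    - by exists set0; [left | split; left].
    - by exists B; [right | split; [left | right]].
    - by exists A; [right | split; [right | left]].
    - have [AB|BA] := Ftot _ _ FA FB.
        by exists B; [right | split; right => //; exact: AB].
      by exists A; [right | split; right => //; exact: BA].
  have sub A : (A = set0 \/ F A) -> G `|` A `<=` G `|` \bigcup_(A in F) A.
    by move=> [->|FA] p [Gp|Ap]; [left|case: Ap|left|right; exists A].
  have good A : (A = set0 \/ F A) -> P A.
    by move=> [->|/FP//]; rewrite /P setU0.
  split; first split.
  - by left; case: GS.
  - move=> k v r w s /both h /h[A FA [Av Aw]]; apply: (sub _ FA).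
    exact: (good _ FA).1.2.
  - move=> v r hv; have [A FA [Av _]] := both _ _ hv hv.
    exact: (good _ FA).2.
set E := G `|` A in ES EP.
have total v : dominated G v -> exists r, E (v, r).
  move=> [b [rb [Gb hb]]].
  have [|a ha] := @extend_graph_positive E v ES EP.
    by exists b, rb; split=> //; left.
  have EvA : extend_graph E v a (v, a).
    exists 1, (fun _ => 0), 0; split; first by case: ES.
    by rewrite mul1r addr0; congr pair; apply/funext => x; rewrite mul1r addr0.
  have EE := @extend_graph_subset E v a.
  have GE : G `|` extend_graph E v a = extend_graph E v a.
    by apply/seteqP; split=> [p [Gp|//]|p]; [apply: EE; left | right].
  exists a; apply: contrapT => nEv; apply: (maxA (extend_graph E v a)).
    split=> [|sub]; first by move=> p Ap; apply: EE; right.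
    by apply: nEv; right; apply: sub.
  by rewrite /P GE; split=> //; apply: extend_graph_subspace.
have [g hg] : exists g : (X -> R) -> R, forall v r, E (v, r) -> g v = r.
  have ex v : exists s, forall r, E (v, r) -> s = r.
    have [[s Es]|nE] := pselect (exists s, E (v, s)).
      by exists s => r Er; exact: (graph_functional ES EP Es Er).
    by exists 0 => r Er; case: nE; exists r.
  by have [g hg] := choice ex; exists g.
exists g; split.
- by move=> v r Gv; apply: hg; left.
- move=> k v w /total[r Er] /total[s Es].
  by rewrite (hg _ _ Er) (hg _ _ Es); apply: hg; apply: ES.2.
- by move=> v /total[r Er] v0; rewrite (hg _ _ Er); apply: EP Er v0.
Qed.

Lemma dominatedL G k v w : graph_subspace G -> dominated G v -> dominated G w ->
  dominated G (fun x => k * v x + w x).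
Proof.
move=> GS [b [r [Gb hb]]] [c [s [Gc hc]]].
exists (fun x => `|k| * b x + c x), (`|k| * r + s); split; first exact: GS.2.
by move=> x; rewrite (le_trans (ler_normD _ _))// lerD// normrM ler_wpM2l.
Qed.

End PositiveExtension.

(** * Interpolation by finitely many functionals *)

Section LinearAlgebra.
Context {R : realType} {V : lmodType R[i]}.
Implicit Types (M : set V) (w : V -> R).

(** The complex space V is regarded as a real one. *)
Definition real_linear w : Prop := forall (a : R) S T, w (a%:C *: S + T) = a * w S + w T.

(** Values of finitely many functionals at T0 are attained on M unless a linear
    combination separates T0 from M. By induction: if the first functional does
    not vanish on M, correct T0 by a multiple of an element of M to bring it into
    the kernel of that functional, and replace M by its intersection with the
    kernel. *)
Lemma finite_interpolation n (w : 'I_n -> V -> R) M (T0 : V) :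
  (forall i, real_linear (w i)) ->
  M 0 -> (forall (a : R) S T, M S -> M T -> M (a%:C *: S + T)) ->
  (forall c : 'I_n -> R, (forall S, M S -> \sum_i c i * w i S = 0) ->
    \sum_i c i * w i T0 = 0) ->
  exists2 S, M S & forall i, w i S = w i T0.
Proof.
elim: n w M T0 => [|n IH] w M T0 wL M0 ML hT; first by exists 0 => // -[].
have w0 i : w i 0 = 0.
  by have := wL i 1 0 0; rewrite scaler0 addr0 mul1r => h; lra.
have wD i S T : w i (S + T) = w i S + w i T.
  by have := wL i 1 S T; rewrite scale1r mul1r.
have wZ i a S : w i (a%:C *: S) = a * w i S.
  by have := wL i a S 0; rewrite !addr0 w0 addr0.
pose w' i := w (lift ord0 i).
have [h0|/existsNP[m /not_implyP[Mm wm]]] := pselect (forall S, M S -> w ord0 S = 0).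
  have [c hc|S MS hS] := IH w' M T0 (fun i => wL _) M0 ML.
    pose c' i := if unlift ord0 i is Some j then c j else 0.
    have := hT c'; rewrite big_ord_recl /c' unlift_none mul0r add0r.
    under eq_bigr do rewrite liftK.
    apply=> S MS; rewrite big_ord_recl unlift_none mul0r add0r.
    under eq_bigr do rewrite liftK.
    exact: hc.
  exists S => // i; have [j ->|->] := unliftP ord0 i; first exact: hS.
  rewrite h0//; have := hT (fun i => (i == ord0)%:R).
  rewrite big_ord_recl big1 ?addr0 ?mul1r//; last by move=> j _; rewrite mul0r.
  move=> -> // S' MS'.
  rewrite big_ord_recl big1 ?addr0 ?mul1r ?h0//.
  by move=> j _; rewrite mul0r.
pose m0 := ((w ord0 m)^-1)%:C *: m.
have Mm0 : M m0 by rewrite -[m0]addr0; apply: ML.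
have wm0 : w ord0 m0 = 1 by rewrite wZ mulVf//; apply/eqP.
pose M' := [set S | M S /\ w ord0 S = 0].
pose T1 := (- w ord0 T0)%:C *: m0 + T0.
have [||c hc|S [MS S0] hS] := IH w' M' T1 (fun i => wL _).
- by split; rewrite ?w0.
- by move=> a S T [MS S0] [MT T0']; split; [exact: ML | rewrite wL S0 T0' mulr0 addr0].
- pose s := \sum_i c i * w' i m0.
  pose c' i := if unlift ord0 i is Some j then c j else - s.
  have E S : \sum_i c' i * w i S = - s * w ord0 S + \sum_i c i * w' i S.
    rewrite big_ord_recl /c' unlift_none; congr (_ + _).
    by under eq_bigr do rewrite liftK.
  have F a S T : \sum_i c i * w' i (a%:C *: S + T) =
      a * (\sum_i c i * w' i S) + \sum_i c i * w' i T.
    rewrite mulr_sumr -big_split; apply: eq_bigr => i _ /=.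
    by rewrite /w' wL; ring.
  rewrite F -/s; have := hT c'; rewrite E => h'; rewrite -[RHS]h'; first by ring.
  move=> S MS; rewrite E.
  have := hc ((- w ord0 S)%:C *: m0 + S); rewrite F -/s => h.
  rewrite -[RHS]h; first by ring.
  by split; [exact: ML | rewrite wL wm0 mulr1 addNr].
exists ((w ord0 T0)%:C *: m0 + S); first exact: ML.
move=> i; have [j ->|->] := unliftP ord0 i; last by rewrite wL wm0 S0 mulr1 addr0.
have := hS j; rewrite /w' wL => ->; rewrite /T1 wL; ring.
Qed.

End LinearAlgebra.

(** * Complete positivity of star homomorphisms *)

Section QuadraticForms.
Context {R : realType} {H : hilbertType R} {I : eqType}.
Implicit Types (s : seq I) (b : I -> I -> bop H) (z : I -> H).

Definition qform s b z : R := \sum_(i <- s) \sum_(j <- s) ri (b i j (z i)) (z j).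

Lemma qform_cons i0 s b z : (forall i, adj (b i0 i) = b i i0) ->
  let w := \sum_(i <- s) b i i0 (z i) in
  qform (i0 :: s) b z =
    ri (b i0 i0 (z i0)) (z i0) + ri w (z i0) + ri (z i0) w + qform s b z.
Proof.
move=> hb w; rewrite /qform !big_cons.
under [X in _ + X]eq_bigr do rewrite big_cons.
rewrite big_split /= ri_suml ri_sumr.
under [X in ri _ _ + X]eq_bigr do rewrite ri_adj hb.
by rewrite -!addrA; congr (_ + _); rewrite addrCA.
Qed.

(** Completion of the square: eliminating the coordinate i0 leaves the form of the
    Schur complement of b i0 i0. The operator d is an inverse of b i0 i0 in the
    corner where the other entries live, as the image of the identity under a
    homomorphism is only a projection. *)
Lemma qform_schur i0 s b d z : (forall i, adj (b i0 i) = b i i0) ->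
  adj d = d ->
  (forall i, bop_comp (b i0 i0) (bop_comp d (b i i0)) = b i i0) ->
  let w := \sum_(i <- s) b i i0 (z i) in
  qform (i0 :: s) b z = ri (b i0 i0 (z i0 + d w)) (z i0 + d w) +
    qform s (fun i j => b i j - bop_comp (b i0 j) (bop_comp d (b i i0))) z.
Proof.
move=> hb dd hd w; rewrite qform_cons// -/w.
have cdw : b i0 i0 (d w) = w.
  rewrite /w !bop_sum; apply: eq_bigr => i _.
  by rewrite -[in RHS](hd i).
have -> : qform s (fun i j => b i j - bop_comp (b i0 j) (bop_comp d (b i i0))) z =
    qform s b z - ri (d w) w.
  rewrite /qform [d w]bop_sum ri_suml -sumrB; apply: eq_bigr => i _.
  rewrite ri_sumr -sumrB; apply: eq_bigr => j _.
  by rewrite bopBE riBl /= (ri_adj (b i0 j)) hb.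
rewrite bopD cdw riDl !riDr (ri_adj _ (z i0) (d w)) hb cdw (ri_sym (d w) w).
by ring.
Qed.

End QuadraticForms.

Section CompletePositivity.
Context {R : realType} {H K : hilbertType R}.
Variables (N : set (bop K)) (f : bop K -> bop H).
Hypotheses (N1 : N (bop_id K)) (hN : star_algebra N) (clN : norm_closed N)
  (hf : star_hom N f).

Lemma star_hom1_le y : ri (f (bop_id K) y) y <= nrm y ^+ 2.
Proof.
rewrite (le_trans (cauchy_schwarz _ _))// expr2 ler_wpM2r ?nrm_ge0//.
rewrite (le_trans (nrm_opnorm _ _))// ler_piMl ?nrm_ge0//.
rewrite (le_trans (star_hom_contractive hN clN hf N1 adj_id
  (fun T _ => bop_comp1l T) (fun T _ => bop_comp1r T) N1))//.
by apply: opnorm_le => // x; rewrite mul1r.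
Qed.

(** The matrix is reduced by Schur complements, on both sides of f at once, to
    single coercive operators of N. The Schur complement is coercive because its
    form at xi is that of the matrix at xi with the eliminated coordinate chosen
    to cancel the square. *)
Lemma qform_coercive_ge0 (I : eqType) (s : seq I) (a : I -> I -> bop K) (e : R) :
  uniq s -> 0 < e -> (forall i j, N (a i j)) -> (forall i j, adj (a i j) = a j i) ->
  (forall xi, e * \sum_(i <- s) nrm (xi i) ^+ 2 <= qform s a xi) ->
  forall z, 0 <= qform s (fun i j => f (a i j)) z.
Proof.
move=> + e0; elim: s a => [|i0 s IH] a; first by move=> _ _ _ _ z; rewrite /qform big_nil.
rewrite cons_uniq => /andP[i0s us] Na aa ha z.
have [_ _ NM NS] := hN; have [_ fM fS] := hf.
have ne i : i \in s -> (i == i0) = false by apply: contraTF => /eqP ->.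
have cc x : e * nrm x ^+ 2 <= ri (a i0 i0 x) x.
  pose xi i := if i == i0 then x else 0.
  have xis i : i \in s -> xi i = 0 by move=> /ne e'; rewrite /xi e'.
  have := ha xi; rewrite qform_cons// big_cons.
  have -> : \sum_(i <- s) a i i0 (xi i) = 0.
    by rewrite big1_seq// => i /andP[_ /xis ->]; rewrite bop0.
  have -> : \sum_(i <- s) nrm (xi i) ^+ 2 = 0.
    by rewrite big1_seq// => i /andP[_ /xis ->]; rewrite nrm0 expr0n.
  have -> : qform s a xi = 0.
    rewrite /qform big1_seq// => i /andP[_ /xis ->].
    by rewrite big1// => j _; rewrite bop0 ri0l.
  by rewrite ri0l ri0r !addr0 /xi eqxx.
have [d [Nd dd cd dc]] := coercive_inverse e0 N1 hN clN (Na i0 i0) (aa i0 i0) cc.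
have hcd i : bop_comp (a i0 i0) (bop_comp d (a i i0)) = a i i0.
  by rewrite bop_compA cd bop_comp1l.
rewrite (@qform_schur _ _ _ _ _ _ (f d)).
- apply: addr_ge0; first exact: (star_hom_coercive_ge0 hN clN hf N1 e0).
  set a' := fun i j => a i j - bop_comp (a i0 j) (bop_comp d (a i i0)).
  have Na' i j : N (a' i j) by apply: star_algebraB => //; do 2 apply: (NM) => //.
  have -> : qform s (fun i j => f (a i j) - bop_comp (f (a i0 j)) (bop_comp (f d) (f (a i i0)))) z
      = qform s (fun i j => f (a' i j)) z.
    apply: eq_bigr => i _; apply: eq_bigr => j _; congr (ri (bop_fun _ _) _).
    by rewrite (star_homB hN hf)//; [rewrite !fM//; exact: NM | do 2 apply: (NM) => //].
  apply: IH => // [i j|xi].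
    by rewrite /a' adjB !adj_comp !aa dd bop_compA.
  pose w := \sum_(i <- s) a i i0 (xi i).
  pose xi' i := if i == i0 then - d w else xi i.
  have xis i : i \in s -> xi' i = xi i by move=> /ne e'; rewrite /xi' e'.
  have := ha xi'; rewrite (@qform_schur _ _ _ _ _ _ d)//.
  have -> : \sum_(i <- s) a i i0 (xi' i) = w.
    by apply: eq_big_seq => i /xis ->.
  rewrite {2 3}/xi' eqxx addNr ri0r add0r => h.
  have -> : qform s a' xi = qform s a' xi'.
    by apply: eq_big_seq => i /xis ->; apply: eq_big_seq => j /xis ->.
  apply: le_trans h; rewrite ler_wpM2l ?(ltW e0)// big_cons.
  have -> : \sum_(i <- s) nrm (xi i) ^+ 2 = \sum_(i <- s) nrm (xi' i) ^+ 2.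
    by apply: eq_big_seq => i /xis ->.
  by rewrite lerDr exprn_ge0 ?nrm_ge0.
- by move=> i; rewrite -fS// aa.
- by rewrite -fS// dd.
- by move=> i; rewrite -!fM ?hcd//; exact: NM.
Qed.

(** Symmetrize the matrix, add e to its diagonal, and let e tend to 0. *)
Lemma qform_ge0 (I : eqType) (s : seq I) (a : I -> I -> bop K) :
  uniq s -> (forall i j, N (a i j)) -> (forall xi, 0 <= qform s a xi) ->
  forall z, 0 <= qform s (fun i j => f (a i j)) z.
Proof.
move=> us Na ha z; have [_ _ NM NS] := hN; have [_ fM fS] := hf.
pose C := \sum_(i <- s) nrm (z i) ^+ 2.
have C0 : 0 <= C by apply: sumr_ge0 => i _; rewrite exprn_ge0 ?nrm_ge0.
pose b e i j := (2^-1)%:C *: (a i j + adj (a j i)) + (if i == j then e%:C *: bop_id K else 0).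
have Nh i j : N ((2^-1)%:C *: (a i j + adj (a j i))).
  by apply: star_algebraZ => //; apply: star_algebraD => //; apply: NS.
have Nd (e : R) i j : N (if i == j :> I then e%:C *: bop_id K else 0).
  by case: ifP => _; [apply: star_algebraZ | case: hN].
(* averaging a with its conjugate transpose does not change the form, and the
   diagonal term adds a multiple of the square norm *)
have qb (G : hilbertType R) (h : I -> I -> bop G) (T : bop G) (e : R) (y : I -> G) :
    \sum_(i <- s) \sum_(j <- s) ri (((2^-1)%:C *: (h i j + adj (h j i)) +
        (if i == j then e%:C *: T else 0)) (y i)) (y j) =
    qform s h y + e * \sum_(i <- s) ri (T (y i)) (y i).
  have E i j : ri (((2^-1)%:C *: (h i j + adj (h j i)) +
        (if i == j then e%:C *: T else 0)) (y i)) (y j) =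
     2^-1 * ri (h i j (y i)) (y j) + 2^-1 * ri (h j i (y j)) (y i) +
     (if j == i then e * ri (T (y i)) (y i) else 0).
    rewrite bopDE bopZE bopDE riDl riZl riDl ri_adjl (ri_sym _ (h j i (y j))) mulrDr.
    congr (_ + _); rewrite (eq_sym i); case: eqP => [->|_]; first by rewrite bopZE riZl.
    by rewrite bop0E ri0l.
  under eq_bigr do under eq_bigr do rewrite E.
  under eq_bigr do rewrite !big_split /=.
  rewrite !big_split /= mulr_sumr; congr (_ + _).
    rewrite [X in _ + X]exchange_big /= -big_split; apply: eq_bigr => i _.
    rewrite -big_split; by apply: eq_bigr => j _ /=; field.
  apply: eq_big_seq => i si; rewrite (bigD1_seq i)//= eqxx big1 ?addr0//.
  by move=> j /negPf ->.
have main (e : R) : 0 < e -> 0 <= qform s (fun i j => f (a i j)) z + e * C.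
  move=> e0.
  have := @qform_coercive_ge0 I s (b e) e us e0.
  have Nb i j : N (b e i j) by apply: star_algebraD.
  move=> /(_ Nb) h.
  have {}h := h _ _ z.
  have fb i j : f (b e i j) = (2^-1)%:C *: (f (a i j) + adj (f (a j i))) +
      (if i == j then e%:C *: f (bop_id K) else 0).
    rewrite (star_homD hf)// (star_homZ hN hf)//; last by apply: star_algebraD => //; apply: NS.
    rewrite (star_homD hf)//; last exact: NS.
    rewrite fS//; congr (_ + _); case: ifP => _; first by rewrite (star_homZ hN hf).
    exact: (star_hom0 hN hf).
  have : 0 <= qform s (fun i j => f (a i j)) z + e * \sum_(i <- s) ri (f (bop_id K) (z i)) (z i).
    rewrite -qb; under eq_bigr do under eq_bigr do rewrite -fb.
    apply: h => [i j|xi].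
      rewrite /b adjD adjZr adjD adjK (addrC (adj _)); congr (_ + _).
      by rewrite eq_sym; case: ifP => _; [rewrite adjZr adj_id | rewrite adj0].
    rewrite /qform qb (le_trans _ (lerD (ha xi) (lexx _)))// add0r.
    rewrite ler_wpM2l ?(ltW e0)// le_eqVlt; apply/orP; left; apply/eqP.
    by apply: eq_bigr => i _; rewrite sqr_nrm.
  move=> /le_trans; apply; rewrite lerD2l ler_wpM2l ?(ltW e0)//.
  by apply: ler_sum => i _; exact: star_hom1_le.
rewrite leNgt; apply/negP => q0.
pose q := - qform s (fun i j => f (a i j)) z.
have C1 : 0 < C + 1 by rewrite ltr_wpDl.
have q0' : 0 < q by rewrite oppr_gt0.
have := main (q / (C + 1)) (divr_gt0 q0' C1).
rewrite leNgt -[qform _ _ _]opprK -/q addrC subr_lt0 mulrAC ltr_pdivrMr//.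
by rewrite mulrDr mulr1 ltrDl q0'.
Qed.

(** The index set of the matrix is the finite set of the vectors that occur, and
    its entries are the sums of the operators attached to the same two vectors. *)
Lemma completely_positive (s : seq (bop K * H * H)) :
  (forall q, q \in s -> N q.1.1) ->
  (forall xi : H -> K, 0 <= \sum_(q <- s) ri (q.1.1 (xi q.1.2)) (xi q.2)) ->
  0 <= \sum_(q <- s) ri (f q.1.1 q.1.2) q.2.
Proof.
move=> Ns pos.
pose pts := undup (map (fun q => q.1.2) s ++ map (fun q => q.2) s).
have p1 q : q \in s -> q.1.2 \in pts.
  by move=> qs; rewrite mem_undup mem_cat (map_f (fun q => q.1.2) qs).
have p2 q : q \in s -> q.2 \in pts.
  by move=> qs; rewrite mem_undup mem_cat (map_f (fun q => q.2) qs) orbT.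
have regroup (G : hilbertType R) (T : bop K * H * H -> bop G) (z : H -> G) :
    qform pts (fun x y => \sum_(q <- s | (q.1.2 == x) && (q.2 == y)) T q) z =
    \sum_(q <- s) ri (T q (z q.1.2)) (z q.2).
  rewrite /qform.
  under eq_bigr => x _.
    under eq_bigr => y _ do rewrite bop_sumE ri_suml big_mkcond.
    rewrite exchange_big /=; over.
  rewrite exchange_big /=; apply: eq_big_seq => q qs.
  rewrite (bigD1_seq q.1.2) ?undup_uniq ?p1//= eqxx /=.
  rewrite [X in _ + X]big1 ?addr0; last first.
    by move=> x /negPf xq; rewrite big1// => y _; rewrite eq_sym xq.
  rewrite (bigD1_seq q.2) ?undup_uniq ?p2//= eqxx.
  rewrite big1 ?addr0// => y /negPf yq; by rewrite eq_sym yq.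
pose a x y := \sum_(q <- s | (q.1.2 == x) && (q.2 == y)) q.1.1.
have Na x y : N (a x y).
  rewrite /a big_seq_cond; apply: star_algebra_sum => // q /andP[qs _].
  exact: Ns.
have := @qform_ge0 _ pts a (undup_uniq _) Na.
have fa : (fun x y => f (a x y)) = (fun x y => \sum_(q <- s | (q.1.2 == x) && (q.2 == y)) f q.1.1).
  apply/funext => x; apply/funext => y; rewrite /a big_seq_cond (star_hom_sum hN hf).
    by rewrite -big_seq_cond.
  by move=> q /andP[/Ns].
move=> /(_ _ id); rewrite fa regroup; apply => xi.
by rewrite /a (regroup _ (fun q => q.1.1)).
Qed.

End CompletePositivity.

(** * Contractive extension of star homomorphisms *)

Section Combinations.
Context {R : realType} {H : hilbertType R}.
Implicit Types (s : seq (R[i] * H)) (q : R[i] * H).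

(** A formal linear combination of vectors of H, evaluated after an arbitrary map
    xi, additive or not. *)
Definition comb (G : hilbertType R) s (xi : H -> G) : G :=
  \sum_(q <- s) q.1 *: xi q.2.

Definition scale_comb (k : R) s : seq (R[i] * H) := [seq (k%:C * q.1, q.2) | q <- s].

Lemma comb_cat (G : hilbertType R) s1 s2 (xi : H -> G) :
  comb (s1 ++ s2) xi = comb s1 xi + comb s2 xi.
Proof. by rewrite /comb big_cat. Qed.

Lemma comb_scale (G : hilbertType R) k s (xi : H -> G) :
  comb (scale_comb k s) xi = k%:C *: comb s xi.
Proof.
rewrite /comb big_map scaler_sumr; apply: eq_bigr => q _ /=.
by rewrite scalerA.
Qed.

Lemma comb1 (G : hilbertType R) a x (xi : H -> G) : comb [:: (a, x)] xi = a *: xi x.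
Proof. by rewrite /comb big_seq1. Qed.

Lemma comb2 (G : hilbertType R) a x b y (xi : H -> G) :
  comb [:: (a, x); (b, y)] xi = a *: xi x + b *: xi y.
Proof. by rewrite /comb big_cons big_seq1. Qed.

End Combinations.

Section ArvesonExtension.
Context {R : realType} {H K : hilbertType R}.
Variables (N : set (bop K)) (f : bop K -> bop H).
Hypotheses (N1 : N (bop_id K)) (hN : star_algebra N) (clN : norm_closed N)
  (hf : star_hom N f).

(** The function xi |-> Re <T (xi x), xi y> on all the maps xi from H to K stands
    for the tensor of T with x and y. Since xi is not required to be linear,
    positivity on N is a statement about matrices indexed by vectors, with no basis
    to choose; the linearity of the extension in x and y is recovered afterwards
    from the Cauchy-Schwarz bound. *)
Definition hom_graph : set (((H -> K) -> R) * R) :=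
  [set p | exists2 s : seq (bop K * H * H), forall q, q \in s -> N q.1.1 &
    p = (fun xi => \sum_(q <- s) ri (q.1.1 (xi q.1.2)) (xi q.2),
         \sum_(q <- s) ri (f q.1.1 q.1.2) q.2)].

Lemma hom_graph_subspace : graph_subspace hom_graph.
Proof.
split; first by exists [::] => //; congr pair; rewrite ?big_nil//; apply/funext => xi; rewrite big_nil.
move=> k _ _ _ _ [s Ns [-> ->]] [s' Ns' [-> ->]].
exists ([seq (k%:C *: q.1.1, q.1.2, q.2) | q <- s] ++ s').
  move=> q; rewrite mem_cat => /orP[/mapP[q' /Ns Nq' ->]|/Ns'//].
  exact: star_algebraZ.
congr pair.
  apply/funext => xi; rewrite big_cat big_map mulr_sumr; congr (_ + _).
  by apply: eq_bigr => q _; rewrite -[RHS]/(ri (k%:C *: q.1.1 (xi q.1.2)) (xi q.2)) riZl.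
rewrite big_cat big_map mulr_sumr; congr (_ + _).
by apply: eq_big_seq => q /Ns Nq /=; rewrite (star_homZ hN hf)// -[RHS]/(ri (k%:C *: f q.1.1 q.1.2) q.2) riZl.
Qed.

Lemma hom_graph_positive : graph_positive hom_graph.
Proof.
by move=> _ _ [s Ns [-> ->]]; apply: (completely_positive N1 hN clN hf).
Qed.

Definition comb_form (T : bop K) (s1 s2 : seq (R[i] * H)) : (H -> K) -> R :=
  fun xi => ri (T (comb s1 xi)) (comb s2 xi).

Let ev (s : seq (R[i] * H)) : H := comb s id.

(** The positive function |comb s xi|^2 belongs to the domain, as a matrix of
    multiples of the identity, and its value is <f 1 v, v> for v = comb s id. *)
Lemma hom_graph_norm s :
  exists2 r, hom_graph (fun xi => nrm (comb s xi) ^+ 2, r) & r <= nrm (ev s) ^+ 2.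
Proof.
pose l := [seq ((q.1^* * p.1)%C *: bop_id K, p.2, q.2) | p <- s, q <- s].
exists (\sum_(q <- l) ri (f q.1.1 q.1.2) q.2).
  exists l; first by move=> _ /allpairsP[[p q] [_ _ ->]] /=; exact: star_algebraZ.
  congr pair; apply/funext => xi; rewrite big_allpairs_dep sqr_nrm /comb ri_suml.
  apply: eq_bigr => p _; rewrite ri_sumr; apply: eq_bigr => q _.
  rewrite -[RHS]/(ri ((q.1^* * p.1)%C *: xi p.2) (xi q.2)).
  by rewrite riZ_conj scalerA.
have -> : \sum_(q <- l) ri (f q.1.1 q.1.2) q.2 = ri (f (bop_id K) (ev s)) (ev s).
  rewrite big_allpairs_dep /ev /comb bop_sum ri_suml.
  apply: eq_bigr => p _; rewrite ri_sumr; apply: eq_bigr => q _ /=.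
  by rewrite (star_homZ hN hf)// -[LHS]/(ri (_ *: _) _) riZ_conj bopZ scalerA.
exact: (star_hom1_le N1 hN clN hf).
Qed.

(** The bound involves the combinations s1 and s2 only through their values in H:
    this is what makes the extended functional a sesquilinear form on H. *)
Lemma comb_form_bound T s1 s2 :
  exists b r, [/\ hom_graph (b, r), forall xi, `|comb_form T s1 s2 xi| <= b xi &
    r <= opnorm T / 2 * (nrm (ev s1) ^+ 2 + nrm (ev s2) ^+ 2)].
Proof.
have [r1 G1 h1] := hom_graph_norm s1; have [r2 G2 h2] := hom_graph_norm s2.
have := graph_scale (opnorm T / 2) hom_graph_subspace (graph_add hom_graph_subspace G1 G2).
set b := fun x => _; set r := _ * _ => Gb.
have T0 : 0 <= opnorm T / 2 by rewrite divr_ge0 ?opnorm_ge0.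
exists b, r; split=> //; last by rewrite /r ler_wpM2l// lerD.
move=> xi; rewrite /b /comb_form (le_trans (abs_ri _ _))//.
set x := comb s1 xi; set y := comb s2 xi.
have h3 : nrm (T x) * nrm y <= opnorm T * (nrm x * nrm y).
  by rewrite mulrA ler_wpM2r ?nrm_ge0 ?nrm_opnorm.
rewrite (le_trans h3)// -mulrA ler_wpM2l ?opnorm_ge0//.
by have := sqr_ge0 (nrm x - nrm y); nra.
Qed.

Lemma comb_form_dominated T s1 s2 : dominated hom_graph (comb_form T s1 s2).
Proof. by have [b [r [Gb hb _]]] := comb_form_bound T s1 s2; exists b, r. Qed.

(** Arveson's extension theorem for star homomorphisms. The functional defined by f
    is positive by complete positivity, and its positive extension is, for every
    T, a form on H bounded by the norm of T. *)
Theorem star_hom_extension : exists F : bop K -> bop H,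
  [/\ forall (a : R[i]) T S, F (a *: T + S) = a *: F T + F S,
      forall T, opnorm (F T) <= opnorm T &
      forall T, N T -> F T = f T].
Proof.
have GS := hom_graph_subspace.
have [g [gG gL gP]] := positive_extension GS hom_graph_positive.
have gD v w : dominated hom_graph v -> dominated hom_graph w ->
    g (fun x => v x + w x) = g v + g w.
  move=> dv dw; have := gL 1 v w dv dw.
  by rewrite mul1r; under eq_fun do rewrite mul1r.
have g0 : g (fun _ => 0) = 0 by apply: gG; case: GS.
have d0 : dominated hom_graph (fun _ => 0).
  by exists (fun _ => 0), 0; split=> [|x]; [case: GS | rewrite normr0].
have gZ k v : dominated hom_graph v -> g (fun x => k * v x) = k * g v.
  move=> dv; have := gL k v _ dv d0.
  by rewrite g0 addr0; under eq_fun do rewrite addr0.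
pose psi T s1 s2 := g (comb_form T s1 s2).
have psi_le T s1 s2 : psi T s1 s2 <= opnorm T / 2 * (nrm (ev s1) ^+ 2 + nrm (ev s2) ^+ 2).
  have [b [r [Gb hb hr]]] := comb_form_bound T s1 s2.
  have db : dominated hom_graph b.
    exists b, r; split=> // x; rewrite ger0_norm//.
    exact: le_trans (normr_ge0 _) (hb x).
  rewrite (le_trans _ hr)// -(gG _ _ Gb) -subr_ge0.
  have := gL (-1) _ _ (comb_form_dominated T s1 s2) db.
  rewrite mulN1r addrC => <-; apply: gP; first exact: dominatedL (comb_form_dominated _ _ _) db.
  by move=> x; rewrite mulN1r addrC subr_ge0 (le_trans (ler_norm _)).
have psi_catl T s1 s1' s2 : psi T (s1 ++ s1') s2 = psi T s1 s2 + psi T s1' s2.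
  rewrite /psi -gD; try exact: comb_form_dominated.
  by congr g; apply/funext => xi; rewrite /comb_form comb_cat bopD riDl.
have psi_catr T s1 s2 s2' : psi T s1 (s2 ++ s2') = psi T s1 s2 + psi T s1 s2'.
  rewrite /psi -gD; try exact: comb_form_dominated.
  by congr g; apply/funext => xi; rewrite /comb_form comb_cat riDr.
have psi_scalel T k s1 s2 : psi T (scale_comb k s1) s2 = k * psi T s1 s2.
  rewrite /psi -gZ; last exact: comb_form_dominated.
  by congr g; apply/funext => xi; rewrite /comb_form comb_scale bopZ riZl.
have psi_scaler T k s1 s2 : psi T s1 (scale_comb k s2) = k * psi T s1 s2.
  rewrite /psi -gZ; last exact: comb_form_dominated.
  by congr g; apply/funext => xi; rewrite /comb_form comb_scale riZr.
(* scaling turns a one-sided bound that ignores x into x = 0 *)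
have bounded0 (x C : R) : (forall k : R, k * x <= C) -> x = 0.
  move=> hk; apply/eqP; apply: contraT => x0.
  by have := hk ((C + 1) / x); rewrite divfK// leNgt ltrDl ltr01.
have psi0l T s1 s2 : ev s1 = 0 -> psi T s1 s2 = 0.
  move=> e1; apply: (@bounded0 _ (opnorm T / 2 * nrm (ev s2) ^+ 2)) => k.
  rewrite -psi_scalel (le_trans (psi_le _ _ _))//.
  by rewrite /ev comb_scale -/(ev s1) e1 scaler0 nrm0 expr0n add0r.
have psi0r T s1 s2 : ev s2 = 0 -> psi T s1 s2 = 0.
  move=> e2; apply: (@bounded0 _ (opnorm T / 2 * nrm (ev s1) ^+ 2)) => k.
  rewrite -psi_scaler (le_trans (psi_le _ _ _))//.
  by rewrite /ev comb_scale -/(ev s2) e2 scaler0 nrm0 expr0n addr0.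
have psi_evl T s1 s1' s2 : ev s1 = ev s1' -> psi T s1 s2 = psi T s1' s2.
  move=> e1; apply/eqP; rewrite -subr_eq0 -mulN1r -psi_scalel -psi_catl; apply/eqP/psi0l.
  by rewrite /ev comb_cat comb_scale -/(ev s1) -/(ev s1') e1 rmorphN rmorph1 scaleN1r subrr.
have psi_evr T s1 s2 s2' : ev s2 = ev s2' -> psi T s1 s2 = psi T s1 s2'.
  move=> e2; apply/eqP; rewrite -subr_eq0 -mulN1r -psi_scaler -psi_catr; apply/eqP/psi0r.
  by rewrite /ev comb_cat comb_scale -/(ev s2) -/(ev s2') e2 rmorphN rmorph1 scaleN1r subrr.
pose rho T x y := psi T [:: (1, x)] [:: (1, y)].
have psi_move T a x y : psi T [:: (a, x)] [:: (1, y)] = rho T x (a^*%C *: y).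
  have -> : rho T x (a^*%C *: y) = psi T [:: (1, x)] [:: (a^*%C, y)].
    by apply: psi_evr; rewrite /ev !comb1 scale1r.
  congr g; apply/funext => xi; rewrite /comb_form !comb1 !scale1r bopZ.
  exact: riZ.
have ex T : exists2 S : bop H, forall x y, ri (S x) y = rho T x y & opnorm S <= opnorm T.
  apply: bop_of_form; first exact: opnorm_ge0.
  - move=> a x x' y; rewrite -psi_move.
    rewrite -[rho T x' y]/(psi T [:: (1, x')] [:: (1, y)]) -psi_catl.
    by apply: psi_evl; rewrite /ev comb1 comb2 !scale1r.
  - move=> k x y y'; rewrite /rho -psi_scaler -psi_catr.
    by apply: psi_evr; rewrite /ev comb_cat comb_scale !comb1 !scale1r.
  - move=> x y; have := nrm_ge0 x; rewrite le_eqVlt => /orP[/eqP/esym x0|x0].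
      rewrite x0 mulr0 mul0r /rho psi0l// /ev comb1 (nrm0_eq0 x0).
      by rewrite scaler0.
    have := nrm_ge0 y; rewrite le_eqVlt => /orP[/eqP/esym y0|y0].
      by rewrite y0 mulr0 /rho psi0r// /ev comb1 (nrm0_eq0 y0) scaler0.
    have := psi_le T (scale_comb (nrm y) [:: (1, x)]) (scale_comb (nrm x) [:: (1, y)]).
    rewrite psi_scalel psi_scaler -/(rho T x y) /ev !comb_scale !comb1 !scale1r !nrmZr.
    rewrite !gtr0_norm// => h; rewrite -(ler_pM2l x0) -(ler_pM2l y0).
    rewrite (le_trans h)// le_eqVlt; apply/orP; left; apply/eqP; by field.
have ex' T : exists S : bop H, (forall x y, ri (S x) y = rho T x y) /\ opnorm S <= opnorm T.
  by have [S h1 h2] := ex T; exists S.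
have [F hF] := choice ex'.
exists F; split.
- move=> a T S; apply: bopP => x; apply: ri_eq => y.
  rewrite bopDE bopZE riDl riZ !(hF _).1 -psi_move /rho /psi.
  rewrite -gD; try exact: comb_form_dominated.
  congr g; apply/funext => xi; rewrite /comb_form !comb1 !scale1r bopDE bopZE riDl.
  by rewrite bopZ.
- by move=> T; case: (hF T).
- move=> T NT; apply: bopP => x; apply: ri_eq => y; rewrite (hF T).1; apply: gG.
  exists [:: (T, x, y)]; first by move=> q; rewrite inE => /eqP ->.
  by rewrite big_seq1; congr pair; apply/funext => xi; rewrite big_seq1 /comb_form !comb1 !scale1r.
Qed.

End ArvesonExtension.

(** * Amplifications and slices *)

Section TensorMaps.
Context {R : realType} {H K : hilbertType R}.

(** Unlike a bilinear map in bundled form, this can be flipped, which gives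
    amplifications and slices on both sides from one construction. *)
Definition tensor_map (t : H -> H -> K) : Prop :=
  [/\ forall a x x' y, t (a *: x + x') y = a *: t x y + t x' y,
      forall a x y y', t x (a *: y + y') = a *: t x y + t x y',
      forall x1 y1 x2 y2, inner (t x1 y1) (t x2 y2) = inner x1 x2 * inner y1 y2 &
      forall w, (forall x y, ri w (t x y) = 0) -> w = 0].

Lemma tensor_map_flip t : tensor_map t -> tensor_map (fun x y => t y x).
Proof. by case=> tl tr ti td; split=> // [*|w hw]; [rewrite ti mulrC | apply: td]. Qed.

Lemma hilbert_tensor_map (t : {bilinear H -> H -> K}) : hilbert_tensor t -> tensor_map t.
Proof.
case=> ti tc; split=> //.
- by move=> a x x' y; rewrite linearPl.
- by move=> a x y y'; rewrite linearPr.
- move=> w hw; apply/nrm0_eq0/eqP; apply: contraT => w0.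
  have w1 : 0 < nrm w by rewrite lt_neqAle eq_sym w0 nrm_ge0.
  have : closure [set z : K | exists n (x y : 'I_n -> H), z = \sum_(i < n) t (x i) (y i)] w.
    by rewrite tc.
  have e0 : 0 < (nrm w)%:C by rewrite ltcR.
  move=> /(_ _ (nbhsx_ballx w _ e0)) [_ [[n [x [y ->]]]]].
  rewrite -ball_normE /= normE ltcR; set u := \sum_(i < n) _ => wu.
  have : ri w (w - u) < nrm w ^+ 2.
    by rewrite (le_lt_trans (cauchy_schwarz _ _))// expr2 ltr_pM2l.
  rewrite riBr -sqr_nrm [ri w u](_ : _ = 0) ?subr0 ?ltxx//.
  by rewrite /u ri_sumr big1.
Qed.

Variables (t : H -> H -> K) (ht : tensor_map t).
Implicit Types (x y z : H) (w : K) (T S : bop H).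

Lemma tensor0l y : t 0 y = 0.
Proof.
have [tl _ _ _] := ht; have := tl 1 0 0 y; rewrite scale1r addr0 scale1r.
by move/esym/(canRL (addrK _)); rewrite subrr.
Qed.

Lemma tensor0r x : t x 0 = 0.
Proof.
have [_ tr _ _] := ht; have := tr 1 x 0 0; rewrite scale1r addr0 scale1r.
by move/esym/(canRL (addrK _)); rewrite subrr.
Qed.

Lemma tensorDl x x' y : t (x + x') y = t x y + t x' y.
Proof. by have [tl _ _ _] := ht; have := tl 1 x x' y; rewrite !scale1r. Qed.

Lemma tensorZl a x y : t (a *: x) y = a *: t x y.
Proof. by have [tl _ _ _] := ht; have := tl a x 0 y; rewrite tensor0l !addr0. Qed.

Lemma tensorZr a x y : t x (a *: y) = a *: t x y.
Proof. by have [_ tr _ _] := ht; have := tr a x y 0; rewrite tensor0r !addr0. Qed.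

Lemma tensorDr x y y' : t x (y + y') = t x y + t x y'.
Proof. by have [_ tr _ _] := ht; have := tr 1 x y y'; rewrite !scale1r. Qed.

Lemma tensor_suml I (s : seq I) (F : I -> H) y :
  t (\sum_(i <- s) F i) y = \sum_(i <- s) t (F i) y.
Proof. by apply: (big_morph (fun x => t x y)) => [u v|]; rewrite ?tensorDl ?tensor0l. Qed.

Lemma inner_nrm x : inner x x = (nrm x ^+ 2)%:C :> R[i].
Proof. by rewrite -sqr_norm_inner normE rmorphXn. Qed.

Lemma nrm_tensor x y : nrm (t x y) = nrm x * nrm y.
Proof.
have [_ _ ti _] := ht; apply/eqP.
rewrite -(@eqrXn2 _ 2) ?nrm_ge0 ?mulr_ge0 ?nrm_ge0// sqr_nrm /ri ti !inner_nrm.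
by rewrite -rmorphM exprMn.
Qed.

Lemma tensor_ext u w : (forall x y, ri u (t x y) = ri w (t x y)) -> u = w.
Proof.
have [_ _ _ td] := ht => h; apply/eqP; rewrite -subr_eq0; apply/eqP/td => x y.
by rewrite riBl h subrr.
Qed.

Lemma tensor_bop_ext (C D : bop K) : (forall x y, C (t x y) = D (t x y)) -> C = D.
Proof.
move=> h; have aCD : adj C = adj D.
  by apply: bopP => w; apply: tensor_ext => x y; rewrite !ri_adjl h.
by rewrite -(adjK C) aCD adjK.
Qed.

Lemma pythagoras (u v : K) : ri u v = 0 -> nrm (u + v) ^+ 2 = nrm u ^+ 2 + nrm v ^+ 2.
Proof. by move=> uv; rewrite !sqr_nrm riDl !riDr uv (ri_sym v) uv addr0 add0r. Qed.

(** Gram-Schmidt on the second components: the terms are projected onto the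
    orthogonal complement of one second component y, which splits both sums into
    orthogonal parts, one of them the elementary tensor with y. *)
Lemma amplification_bound T (s : seq (H * H)) :
  nrm (\sum_(p <- s) t (T p.1) p.2) <= opnorm T * nrm (\sum_(p <- s) t p.1 p.2).
Proof.
have [_ _ ti _] := ht.
rewrite -(@ler_pXn2r _ 2) ?nnegrE ?nrm_ge0 ?mulr_ge0 ?opnorm_ge0 ?nrm_ge0// exprMn.
have [n] := ubnP (size s); elim: n s => // n IH [|[x y] s] /=.
  by move=> _; rewrite !big_nil nrm0 expr0n mulr0.
rewrite ltnS => sn; rewrite !big_cons /=.
have [y0|y0] := eqVneq (inner y y) 0.
  have -> : y = 0 by apply: ri0_eq0; rewrite /ri y0.
  by rewrite !tensor0r !add0r; apply: IH.
pose c z : R[i] := inner z y / inner y y.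
pose s' := [seq (p.1, p.2 - c p.2 *: y) | p <- s].
pose X := x + \sum_(p <- s) c p.2 *: p.1.
have E (F : H -> H) : (forall u v, F (u + v) = F u + F v) ->
    (forall a u, F (a *: u) = a *: F u) -> F 0 = 0 ->
    t (F x) y + \sum_(p <- s) t (F p.1) p.2 =
    t (F X) y + \sum_(p <- s') t (F p.1) p.2.
  move=> FD FZ F0; rewrite big_map /X FD tensorDl -addrA; congr (_ + _).
  rewrite (big_morph F FD F0) tensor_suml -big_split; apply: eq_bigr => p _ /=.
  rewrite FZ tensorZl -tensorZr -tensorDr.
  by rewrite addrC subrK.
have orth (F : H -> H) u : ri (t u y) (\sum_(p <- s') t (F p.1) p.2) = 0.
  rewrite big_map ri_sumr big1_seq// => q /andP[_ qs].
  rewrite /ri ti.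
  suff -> : inner y (q.2 - c q.2 *: y) = 0 :> R[i] by rewrite mulr0.
  rewrite (@hermitian_subproof _ _ _ _ inner y) expr0 mul1r.
  by rewrite linearBl linearZl_LR /= /c divfK// subrr rmorph0.
have E1 : t x y + \sum_(p <- s) t p.1 p.2 = t X y + \sum_(p <- s') t p.1 p.2.
  exact: (E id).
have o1 : ri (t X y) (\sum_(p <- s') t p.1 p.2) = 0 by exact: (orth id).
rewrite (E T (bopD T) (bopZ T) (bop0 T)) E1 (pythagoras (orth T _)) (pythagoras o1).
rewrite mulrDr lerD//; last by apply: IH; rewrite size_map.
rewrite -exprMn ler_pXn2r ?nnegrE ?nrm_ge0 ?mulr_ge0 ?opnorm_ge0 ?nrm_ge0//.
by rewrite !nrm_tensor mulrA ler_wpM2r ?nrm_ge0 ?nrm_opnorm.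
Qed.

(** The elementary tensors only span a dense subspace, so the adjoint is constructed
    instead: its value at w represents, by the Riesz theorem, the functional
    t x y |-> <w, t (T x) y>. *)
Lemma amplification T :
  exists2 D : bop K, forall x y, D (t x y) = t (T x) y & opnorm D <= opnorm T.
Proof.
have T0 := opnorm_ge0 T.
have ex w : exists z : K, (forall x y, ri z (t x y) = ri w (t (T x) y)) /\
    nrm z <= opnorm T * nrm w.
  pose G (u : K) (r : R) := exists2 s : seq (H * H), u = \sum_(p <- s) t p.1 p.2 &
    r = ri w (\sum_(p <- s) t (T p.1) p.2).
  have [||||z hz zC] := @riesz_graph _ _ G (opnorm T * nrm w).
  - by rewrite mulr_ge0 ?nrm_ge0.
  - by exists [::]; rewrite !big_nil ?ri0r.
  - move=> k _ _ _ _ [s -> ->] [s' -> ->].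
    exists ([seq (k%:C *: p.1, p.2) | p <- s] ++ s').
      rewrite big_cat big_map scaler_sumr; congr (_ + _).
      by apply: eq_bigr => p _; rewrite tensorZl.
    rewrite big_cat big_map -riZr scaler_sumr riDr; congr (ri _ _ + _).
    by apply: eq_bigr => p _; rewrite bopZ tensorZl.
  - move=> _ _ [s -> ->]; apply: le_trans (abs_ri _ _) _.
    apply: le_trans (ler_wpM2l (nrm_ge0 w) (amplification_bound T s)) _.
    by rewrite mulrA (mulrC (nrm w)).
  exists z; split=> // x y; apply: hz; exists [:: (x, y)]; by rewrite big_seq1.
have [f hf] := choice ex.
have [||D Df] := @make_bop _ _ f (opnorm T).
- move=> a w w'; apply: tensor_ext => x y.
  by rewrite (hf _).1 !riDl !riZ -tensorZl -tensorZl -bopZ !(hf _).1.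
- by move=> w; case: (hf w).
exists (adj D).
  by move=> x y; apply: ri_eq => w; rewrite ri_adjl ri_sym Df (hf w).1 ri_sym.
rewrite (le_trans (opnorm_adj _))//; apply: opnorm_le => // w.
by rewrite Df; case: (hf w).
Qed.

Lemma slice_exists x y (X : bop K) :
  exists2 S : bop H, forall u v, ri (S u) v = ri (X (t u x)) (t v y) &
    opnorm S <= opnorm X * (nrm x * nrm y).
Proof.
have [tl _ _ _] := ht.
apply: bop_of_form; first by rewrite !mulr_ge0 ?opnorm_ge0 ?nrm_ge0.
- by move=> a u u' v; rewrite tl bop_lin riDl riZ tensorZl.
- by move=> k u v v'; rewrite tl riDr riZr.
- move=> u v; rewrite (le_trans (cauchy_schwarz _ _))//.
  rewrite (le_trans (ler_wpM2r (nrm_ge0 _) (nrm_opnorm _ _)))// !nrm_tensor.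
  by rewrite le_eqVlt; apply/orP; left; apply/eqP; ring.
Qed.

(** The slice of X by the vector functional of x and y on the second factor. *)
Definition slice x y X : bop H :=
  projT1 (cid2 (slice_exists x y X)).

Lemma sliceE x y X u v : ri (slice x y X u) v = ri (X (t u x)) (t v y).
Proof. by rewrite /slice; case: cid2. Qed.

Lemma slice_bound x y X : opnorm (slice x y X) <= opnorm X * (nrm x * nrm y).
Proof. by rewrite /slice; case: cid2. Qed.

Lemma sliceP x y (X : bop K) S :
  (forall u v, ri (S u) v = ri (X (t u x)) (t v y)) -> slice x y X = S.
Proof. by move=> h; apply: bopP => u; apply: ri_eq => v; rewrite sliceE h. Qed.

Lemma sliceL x y a X Y : slice x y (a *: X + Y) = a *: slice x y X + slice x y Y.
Proof.
apply: sliceP => u v; rewrite !bopDE !bopZE !riDl !riZ !sliceE.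
by rewrite -tensorZl.
Qed.

Lemma sliceB x y X Y : slice x y (X - Y) = slice x y X - slice x y Y.
Proof. by rewrite -scaleN1r addrC sliceL scaleN1r addrC. Qed.

Lemma slice_tensor x y (T S : bop H) (C : bop K) :
  (forall u v, C (t u v) = t (T u) (S v)) ->
  slice x y C = (inner (S x) y : R[i]) *: T.
Proof.
have [_ _ ti _] := ht => hC; apply: sliceP => u v; rewrite hC bopZE /ri ti linearZl_LR /=.
by rewrite mulrC.
Qed.

Lemma slice0 x y : slice x y 0 = 0.
Proof. by apply: sliceP => u v; rewrite !bop0E !ri0l. Qed.

Lemma slice_weak_star_closure (A : set (bop K)) (M : set (bop H)) x y :
  (forall S : bop K, A S -> M (slice x y S)) ->
  forall T : bop K, weak_star_closure A T -> weak_star_closure M (slice x y T).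
Proof.
apply: weak_star_closure_map => p.
have b (z : H) n (u : nat -> H) : nrm (t (u n) z) <= nrm z * nrm (u n).
  by rewrite nrm_tensor mulrC.
have s1 := @sqsum_le _ _ _ _ (fun n => t (seq1 p n) x) _ (fun n => b x n (seq1 p)) (@sqsum1 _ _ p).
have s2 := @sqsum_le _ _ _ _ (fun n => t (seq2 p n) y) _ (fun n => b y n (seq2 p)) (@sqsum2 _ _ p).
exists (mkpair s1 s2) => S T; rewrite -sliceB; apply: eq_rnormal => n.
exact: sliceE.
Qed.

End TensorMaps.

(** * The tensor square of a von Neumann algebra *)

Section TensorAlgebra.
Context {R : realType} {H K : hilbertType R} (t : {bilinear H -> H -> K}).
Hypothesis ht : hilbert_tensor t.
Variable M : set (bop H).
Hypothesis hM : von_neumann_algebra M.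

Let tm : tensor_map t := hilbert_tensor_map ht.

Lemma tensor_exists (T S : bop H) :
  exists2 C : bop K, tensor_operator t T S C & opnorm C <= opnorm T * opnorm S.
Proof.
have [D1 h1 n1] := amplification tm T.
have [D2 h2 n2] := amplification (tensor_map_flip tm) S.
exists (bop_comp D1 D2); first by move=> x y; rewrite /= h2 h1.
by rewrite (le_trans (opnorm_comp _ _))// ler_pM ?opnorm_ge0.
Qed.

Definition tensor (T S : bop H) : bop K := projT1 (cid2 (tensor_exists T S)).

Lemma tensorE T S : tensor_operator t T S (tensor T S).
Proof. by rewrite /tensor; case: cid2. Qed.

Lemma tensor_bound T S : opnorm (tensor T S) <= opnorm T * opnorm S.
Proof. by rewrite /tensor; case: cid2. Qed.

Lemma tensorLl a T T' S : tensor (a *: T + T') S = a *: tensor T S + tensor T' S.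
Proof.
apply: (tensor_bop_ext tm) => x y.
by rewrite [RHS]bopDE [in RHS]bopZE !tensorE bopDE bopZE linearPl.
Qed.

Lemma tensorLr a T S S' : tensor T (a *: S + S') = a *: tensor T S + tensor T S'.
Proof.
apply: (tensor_bop_ext tm) => x y.
by rewrite [RHS]bopDE [in RHS]bopZE !tensorE bopDE bopZE linearPr.
Qed.

Lemma tensor_adj (T S : bop H) (C : bop K) :
  tensor_operator t T S C -> tensor_operator t (adj T) (adj S) (adj C).
Proof.
have [_ _ ti _] := tm => hC x y; apply: (tensor_ext tm) => u v.
rewrite ri_adjl hC /ri !ti.
have e (A : bop H) p q : inner p (A q) = inner (adj A p) q :> R[i].
  by have := adj_adjoint (adj A) p q; rewrite adjK => <-.
by rewrite !e.
Qed.

Let A := algebraic_tensor t M M.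

Lemma algebraic_tensor1 a b c : M a -> M b -> tensor_operator t a b c -> A c.
Proof.
move=> Ma Mb h; exists 1%N, (fun _ => a), (fun _ => b), (fun _ => c); split=> //.
by rewrite big_ord_recl big_ord0 addr0.
Qed.

Lemma algebraic_tensor0 : A 0.
Proof.
by exists 0%N, (fun _ => 0), (fun _ => 0), (fun _ => 0); rewrite big_ord0; split=> // -[].
Qed.

Lemma algebraic_tensorD S T : A S -> A T -> A (S + T).
Proof.
move=> [n [a [b [c [h ->]]]]] [m [a' [b' [c' [h' ->]]]]].
pose u X (f : 'I_n -> X) (g : 'I_m -> X) (i : 'I_(n + m)) :=
  match fintype.split i with inl j => f j | inr j => g j end.
exists (n + m)%N, (u _ a a'), (u _ b b'), (u _ c c'); split.
  by move=> i; rewrite /u; case: fintype.split.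
rewrite big_split_ord; congr (_ + _); apply: eq_bigr => i _.
  by rewrite /u (unsplitK (inl i)).
by rewrite /u (unsplitK (inr i)).
Qed.

Lemma algebraic_tensor_ind (P : bop K -> Prop) : P 0 ->
  (forall S T, P S -> P T -> P (S + T)) ->
  (forall a b c, M a -> M b -> tensor_operator t a b c -> P c) ->
  forall S, A S -> P S.
Proof.
move=> P0 PD P1 _ [n [a [b [c [h ->]]]]]; apply: big_ind => // i _.
by have [Ma Mb hc] := h i; exact: P1 hc.
Qed.

Lemma algebraic_tensor_star_algebra : star_algebra A.
Proof.
have [M1 sM _] := von_neumann_star_algebra hM; have [_ _ MM MS] := sM.
split.
- exact: algebraic_tensor0.
- move=> a S T AS AT; apply: algebraic_tensorD => //.
  apply: (algebraic_tensor_ind (P := fun S => A (a *: S))) AS.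
  + by rewrite scaler0; exact: algebraic_tensor0.
  + by move=> S1 S2; rewrite scalerDr; exact: algebraic_tensorD.
  + move=> b c d Mb Mc hd; apply: (@algebraic_tensor1 (a *: b) c) => //.
      exact: star_algebraZ.
    by move=> x y; rewrite !bopZE hd linearZl_LR.
- move=> S T AS AT; apply: (algebraic_tensor_ind (P := fun T => A (bop_comp S T))) AT.
  + rewrite (_ : bop_comp S 0 = 0); first exact: algebraic_tensor0.
    by apply: bopP => x; exact: bop0.
  + by move=> S1 S2; rewrite bop_compDr; exact: algebraic_tensorD.
  + move=> b c d Mb Mc hd.
    apply: (algebraic_tensor_ind (P := fun S => A (bop_comp S d))) AS.
    * rewrite (_ : bop_comp 0 d = 0); first exact: algebraic_tensor0.
      exact: bopP.
    * by move=> S1 S2; rewrite bop_compDl; exact: algebraic_tensorD.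
    * move=> b' c' d' Mb' Mc' hd'.
      apply: (@algebraic_tensor1 (bop_comp b' b) (bop_comp c' c)); [exact: MM | exact: MM |].
      by move=> x y; rewrite /= hd hd'.
- move=> S; apply: (algebraic_tensor_ind (P := fun S => A (adj S))).
  + by rewrite adj0; exact: algebraic_tensor0.
  + by move=> S1 S2; rewrite adjD; exact: algebraic_tensorD.
  + move=> b c d Mb Mc hd; apply: (@algebraic_tensor1 (adj b) (adj c)); try exact: MS.
    exact: tensor_adj.
Qed.

Lemma vn_tensor_star_algebra :
  [/\ vn_tensor t M M (bop_id K), star_algebra (vn_tensor t M M) &
      norm_closed (vn_tensor t M M)].
Proof.
have [M1 _ _] := von_neumann_star_algebra hM.
split; last exact: norm_closed_weak_star_closure.
  apply: subset_weak_star_closure; apply: (@algebraic_tensor1 (bop_id H) (bop_id H)) => //.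
exact: (star_algebra_weak_star_closure algebraic_tensor_star_algebra).
Qed.

Lemma vn_tensor_tensor a b : M a -> M b -> vn_tensor t M M (tensor a b).
Proof.
move=> Ma Mb; apply: subset_weak_star_closure; apply: algebraic_tensor1 Ma Mb _.
exact: tensorE.
Qed.

Lemma slice_vn_tensor x y X : vn_tensor t M M X -> M (slice tm x y X).
Proof.
have [_ sM _] := von_neumann_star_algebra hM; have [_ _ _ _ clM] := hM.
move=> NX; rewrite -clM.
refine (@slice_weak_star_closure _ _ _ _ tm A M x y _ X NX) => S.
apply: (algebraic_tensor_ind (P := fun S => M (slice tm x y S))).
- by rewrite slice0; case: sM.
- move=> S1 S2 h1 h2; have := sliceL tm x y 1 S1 S2; rewrite !scale1r => ->.
  exact: star_algebraD.
- by move=> a b c Ma Mb hc; rewrite (slice_tensor tm _ _ hc); exact: star_algebraZ.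
Qed.

Lemma slice_flip_vn_tensor x y X : vn_tensor t M M X ->
  M (slice (tensor_map_flip tm) x y X).
Proof.
have [_ sM _] := von_neumann_star_algebra hM; have [_ _ _ _ clM] := hM.
move=> NX; rewrite -clM.
refine (@slice_weak_star_closure _ _ _ _ (tensor_map_flip tm) A M x y _ X NX) => S.
apply: (algebraic_tensor_ind (P := fun S => M (slice (tensor_map_flip tm) x y S))).
- by rewrite slice0; case: sM.
- move=> S1 S2 h1 h2; have := sliceL (tensor_map_flip tm) x y 1 S1 S2; rewrite !scale1r => ->.
  exact: star_algebraD.
- move=> a b c Ma Mb hc.
  rewrite (@slice_tensor _ _ _ _ (tensor_map_flip tm) x y b a c); last by move=> u v; exact: hc.
  exact: star_algebraZ.
Qed.

End TensorAlgebra.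

(** * Averaging contractions into a projection *)

Section Projections.
Context {R : realType} {H : hilbertType R}.
Implicit Types (M : set (bop H)) (P : bop H -> bop H) (C : R).

Definition linear_map (K : hilbertType R) (P : bop K -> bop H) : Prop :=
  forall (a : R[i]) T S, P (a *: T + S) = a *: P T + P S.

Definition bounded_projection M C P : Prop :=
  [/\ linear_map P, forall T, M (P T), forall T, M T -> P T = T &
      forall T, opnorm (P T) <= C * opnorm T].

Lemma bounded_projection_linear M C P : bounded_projection M C P ->
  linear_projection_onto setT M P.
Proof.
case=> PL PM PI _; split=> //.
  by apply/seteqP; split=> [_ [T _ <-]//|T MT]; exists T => //; exact: PI.
by move=> T _; apply: PI.
Qed.

Lemma linear_projection_bounded M C P : linear_projection_onto setT M P ->
  (forall T, opnorm (P T) <= C * opnorm T) -> bounded_projection M C P.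
Proof.
case=> PL _ PM PP PC; split=> // [a T S|T|T].
- exact: PL.
- by rewrite -PM; exists T.
- by rewrite -PM => -[S _ <-]; exact: PP.
Qed.

Lemma contractively_complementedP M :
  (exists P, bounded_projection M 1 P) -> contractively_complemented M setT.
Proof.
move=> [P hP]; exists P; split; first exact: bounded_projection_linear hP.
by move=> T _; have [_ _ _ /(_ T)] := hP; rewrite mul1r.
Qed.

Definition contractions M : set (bop H -> bop H) :=
  [set G | [/\ linear_map G, forall T, M (G T) & forall T, opnorm (G T) <= opnorm T]].

Definition trace_form (s : seq (bop H * H * H)) (G : bop H -> bop H) : R :=
  \sum_(q <- s) ri (G q.1.1 q.1.2) q.2.

(** The tensor s in the product of M with its predual has trace trace_form s id. Its
    norm in the projective tensor product of B(H) with the predual of M is the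
    supremum of the values trace_form s G, so this inequality compares trace and
    norm; it is the dual form of the existence of a contractive projection. *)
Definition trace_bounded M : Prop := forall s k, (forall q, q \in s -> M q.1.1) ->
  (forall G, contractions M G -> trace_form s G <= k) -> trace_form s id <= k.

End Projections.

Section MeanProjection.
Context {R : realType} {H : hilbertType R}.
Variable M : set (bop H).
Hypotheses (hM : von_neumann_algebra M) (tb : trace_bounded M).

Let X := {G : bop H -> bop H | contractions M G}.

Definition trace_graph : set ((X -> R) * R) :=
  [set p | exists s k, (forall q, q \in s -> M q.1.1) /\
    p = (fun G : X => trace_form s (sval G) + k, trace_form s id + k)].

Lemma trace_graph_subspace : graph_subspace trace_graph.
Proof.
have [_ sM _] := von_neumann_star_algebra hM.
split.
  exists [::], 0; split=> //; rewrite /trace_form big_nil addr0; congr pair.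
  by apply/funext => G; rewrite big_nil addr0.
move=> k _ _ _ _ [s [c [Ms [-> ->]]]] [s' [c' [Ms' [-> ->]]]].
have E (G : bop H -> bop H) : linear_map G ->
    trace_form ([seq (k%:C *: q.1.1, q.1.2, q.2) | q <- s] ++ s') G =
    k * trace_form s G + trace_form s' G.
  move=> GL; rewrite /trace_form big_cat big_map mulr_sumr; congr (_ + _).
  apply: eq_bigr => q _ /=.
  have G0 : G 0 = 0.
    have := GL 1 0 0; rewrite !scale1r addr0 => /esym/(canRL (addrK _)).
    by rewrite subrr.
  by have := GL k%:C q.1.1 0; rewrite !addr0 G0 addr0 => ->; rewrite -riZl.
exists ([seq (k%:C *: q.1.1, q.1.2, q.2) | q <- s] ++ s'), (k * c + c'); split.
  move=> q; rewrite mem_cat => /orP[/mapP[q' /Ms Mq' ->]|/Ms'//].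
  exact: star_algebraZ.
congr pair; last by rewrite E//; ring.
apply/funext => -[G [GL GM GC]] /=; rewrite E//; ring.
Qed.

(** The inequality is applied to the tensor opposite to s. *)
Lemma trace_graph_positive : graph_positive trace_graph.
Proof.
move=> _ _ [s [k [Ms [-> ->]]]] pos.
have [_ sM _] := von_neumann_star_algebra hM.
pose s' := [seq (q.1.1, q.1.2, - q.2) | q <- s].
have E G : trace_form s' G = - trace_form s G.
  by rewrite /trace_form big_map -sumrN; apply: eq_bigr => q _; rewrite riNr.
have Ms' q : q \in s' -> M q.1.1 by move=> /mapP[q' /Ms Mq' ->].
have := tb (k := k) Ms'; rewrite E => h; have {}h := h _.
suff : - trace_form s id <= k by lra.
apply: h => G hG; rewrite E; have := pos (exist _ G hG); rewrite /=; lra.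
Qed.

(** A positive extension g of the graph is a mean over the contractions G of B(H)
    into M, and the mean of the operators G T is P T. A normal functional commutes
    with the mean, because its series converges uniformly on bounded sets; hence
    a combination of normal functionals that vanishes on M vanishes at P T, and
    interpolation puts P T in the weak-star closure of M. *)
Lemma mean_projection : exists P, bounded_projection M 1 P.
Proof.
have GS := trace_graph_subspace.
have [_ sM clM'] := von_neumann_star_algebra hM.
have [g [gG gL gP]] := positive_extension GS trace_graph_positive.
have Gc (c : R) : trace_graph (fun _ => c, c).
  exists [::], c; split=> //; rewrite /trace_form big_nil add0r; congr pair.
  by apply/funext => G; rewrite big_nil add0r.
have gc c : g (fun _ => c) = c by apply: gG.
have dom (c : R) v : (forall G, `|v G| <= c) -> dominated trace_graph v.
  by move=> hv; exists (fun _ => c), c; split.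
have domc c : dominated trace_graph (fun _ => c).
  by apply: (dom `|c|) => G.
have gD v w : dominated trace_graph v -> dominated trace_graph w ->
    g (fun x => v x + w x) = g v + g w.
  by move=> dv dw; have := gL 1 v w dv dw; rewrite mul1r; under eq_fun do rewrite mul1r.
have gZ k v : dominated trace_graph v -> g (fun x => k * v x) = k * g v.
  move=> dv; have := gL k v _ dv (domc 0).
  by rewrite gc addr0; under eq_fun do rewrite addr0.
have gB v w : dominated trace_graph v -> dominated trace_graph w ->
    g (fun x => v x - w x) = g v - g w.
  move=> dv dw; have := gL (-1) w v dw dv; rewrite mulN1r addrC => <-.
  by congr g; apply/funext => x; rewrite mulN1r addrC.
have g_abs c v : (forall G, `|v G| <= c) -> `|g v| <= c.
  move=> hv; have dv := dom _ _ hv; rewrite ler_norml; apply/andP; split.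
    rewrite -subr_ge0 opprK -[X in _ + X](gc c) -gD//; apply: gP.
      by have := dominatedL 1 GS dv (domc c); under eq_fun do rewrite mul1r.
    by move=> G; have := hv G; rewrite ler_norml -subr_ge0 opprK => /andP[].
  rewrite -subr_ge0 -[X in X - _](gc c) -gB//; apply: gP.
    have := dominatedL (-1) GS dv (domc c).
    by under eq_fun do rewrite mulN1r addrC.
  by move=> G; have := hv G; rewrite ler_norml subr_ge0 => /andP[].
have g_sum (n : nat) (v : nat -> X -> R) : (forall i, dominated trace_graph (v i)) ->
    dominated trace_graph (fun G => \sum_(0 <= i < n) v i G) /\
    g (fun G => \sum_(0 <= i < n) v i G) = \sum_(0 <= i < n) g (v i).
  move=> dv; elim: n => [|n [IHd IHg]].
    rewrite (_ : (fun G => _) = fun _ => 0) ?big_geq ?gc//.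
    by apply/funext => G; rewrite big_geq.
  rewrite (_ : (fun G => _) = fun G => \sum_(0 <= i < n) v i G + v n G); last first.
    by apply/funext => G; rewrite big_nat_recr.
  rewrite big_nat_recr//= -IHg -gD//; split=> //.
  by have := dominatedL 1 GS IHd (dv n); under eq_fun do rewrite mul1r.
pose e T x y : X -> R := fun G => ri (sval G T x) y.
have e_bound T x y G : `|e T x y G| <= opnorm T * nrm x * nrm y.
  case: G => G [GL GM GC]; rewrite /e /= (le_trans (abs_ri _ _))//.
  by rewrite ler_wpM2r ?nrm_ge0//; apply: nrm_bop_le.
have de T x y : dominated trace_graph (e T x y) by exact: dom (e_bound T x y).
have ex T : exists S : bop H, (forall x y, ri (S x) y = g (e T x y)) /\ opnorm S <= opnorm T.
  have [||||S h1 h2] := @bop_of_form _ _ (fun x y => g (e T x y)) (opnorm T); last by exists S.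
  - exact: opnorm_ge0.
  - move=> a x x' y; rewrite -gD//; congr g; apply/funext => G.
    by rewrite /e bop_lin riDl riZ.
  - move=> k x y y'; rewrite -gL//; congr g; apply/funext => G.
    by rewrite /e riDr riZr.
  - by move=> x y; rewrite (le_trans (ler_norm _))// g_abs.
have [P hP] := choice ex.
have PE p T : rnormal p (P T) = g (fun G => rnormal p (sval G T)).
  have dn : dominated trace_graph (fun G => rnormal p (sval G T)).
    apply: (dom (opnorm T * tail p 0)) => -[G [GL GM GC]] /=.
    by rewrite (le_trans (rnormal_bound _ _))// ler_wpM2r ?tail_ge0.
  apply/eqP; rewrite -subr_eq0 -normr_le0; apply/ler_addgt0Pr => d d0; rewrite add0r.
  have D0 : 0 < 2 * opnorm T + 1 by rewrite ltr_wpDl// mulr_ge0 ?opnorm_ge0.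
  have [n hn] := tail_small p (divr_gt0 d0 D0).
  pose v i : X -> R := fun G => pairing (sval G T) p i.
  have [dsum gsum] := g_sum n v (fun i => de T (seq1 p i) (seq2 p i)).
  have sE : \sum_(0 <= i < n) g (v i) = series (pairing (P T) p) n.
    by rewrite seriesEnat; apply: eq_bigr => i _; rewrite /pairing (hP T).1.
  have h1 := rnormal_tail p (P T) n.
  have h2 : `|g (fun G => rnormal p (sval G T)) - series (pairing (P T) p) n| <= opnorm T * tail p n.
    rewrite -sE -gsum -gB//; apply: g_abs => -[G [GL GM GC]] /=.
    have := rnormal_tail p (G T) n; rewrite seriesEnat => /le_trans; apply.
    by rewrite ler_wpM2r ?tail_ge0.
  have h3 : opnorm (P T) * tail p n <= opnorm T * tail p n.
    by rewrite ler_wpM2r ?tail_ge0 ?(hP T).2.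
  set a := rnormal p _ in h1 *; set b := g _ in h2 *; set c := series _ n in h1 h2.
  have -> : a - b = (a - c) - (b - c) by ring.
  rewrite (le_trans (ler_normB _ _))//.
  have T0 := opnorm_ge0 T; have t0 := tail_ge0 p n.
  move: hn; rewrite ltr_pdivlMr// => hn.
  nra.
have Plin : linear_map P.
  move=> a T S; apply: bopP => x; apply: ri_eq => y.
  rewrite bopDE bopZE riDl riZ !(hP _).1 -gD//; congr g; apply/funext => -[G [GL GM GC]].
  by rewrite /e /= GL bopDE bopZE riDl riZ.
exists P; split=> //; last by move=> T; rewrite mul1r; case: (hP T).
  move=> T; have [_ _ _ _ <-] := hM; apply/weak_star_closureP => s d d0.
  case: s => [|p0 s]; first by exists 0; [case: sM | move=> p []].
  have [|||c hc|S MS hS] := @finite_interpolation _ _ (size (p0 :: s))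
    (fun i => rnormal (nth p0 (p0 :: s) i)) M (P T).
  - by move=> i a U V; exact: rnormalL.
  - by case: sM.
  - by move=> a U V MU MV; apply: star_algebraD => //; apply: star_algebraZ.
  - pose v i : X -> R := fun G => rnormal (nth p0 (p0 :: s) i) (sval G T).
    have dv i : dominated trace_graph (v i).
      apply: (dom (opnorm T * tail (nth p0 (p0 :: s) i) 0)) => -[G [GL GM GC]].
      by rewrite /v (le_trans (rnormal_bound _ _))// ler_wpM2r ?tail_ge0//; exact: GC.
    pose c' i := if insub i is Some j then c j else 0.
    have c'E (i : 'I_(size (p0 :: s))) : c' i = c i by rewrite /c' valK.
    have dvc i : dominated trace_graph (fun G => c' i * v i G).
      by have := dominatedL (c' i) GS (dv i) (domc 0); under eq_fun do rewrite addr0.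
    have [_] := g_sum (size (p0 :: s)) (fun i G => c' i * v i G) dvc.
    rewrite (_ : (fun G => _) = fun _ => 0); last first.
      apply/funext => -[G [GL GM GC]]; rewrite big_mkord -[RHS](hc (G T) (GM T)).
      by apply: eq_bigr => i _; rewrite c'E.
    rewrite gc big_mkord => /esym; under eq_bigr => i _ do rewrite gZ// c'E -PE.
    by [].
  exists S => // p ps.
  have [i [si <-]] : exists i, (i < size (p0 :: s))%N /\ nth p0 (p0 :: s) i = p.
    elim: (p0 :: s) ps => //= q l IH [<-|/IH[i [il <-]]]; first by exists 0%N.
    by exists i.+1.
  by rewrite rnormalB (hS (Ordinal si)) subrr normr0.
move=> T MT; apply: bopP => x; apply: ri_eq => y; rewrite (hP T).1; apply: gG.
exists [:: (T, x, y)], 0; split; first by move=> q; rewrite inE => /eqP ->.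
rewrite /trace_form big_seq1 addr0; congr pair.
by apply/funext => G; rewrite big_seq1 addr0.
Qed.
End MeanProjection.

(** * Improving the norm of a projection *)

Section TensorProjection.
Context {R : realType} {H K : hilbertType R} (t : {bilinear H -> H -> K}).
Hypothesis ht : hilbert_tensor t.
Variable M : set (bop H).
Hypothesis hM : von_neumann_algebra M.

Let N := vn_tensor t M M.
Let tm : tensor_map t := hilbert_tensor_map ht.

(** The inverse isomorphism embeds N onto all of M, of which the identity is a
    contractive projection. *)
Lemma vn_isomorphic_embeds : vn_isomorphic M N -> embeds_contractively_complemented N M.
Proof.
have [M1 sM _] := von_neumann_star_algebra hM; have [_ ML MM MS] := sM.
have [N1 sN _] := vn_tensor_star_algebra ht hM; have [_ NL NM NS] := sN.
move=> [f [[fN fL fM fA fI] fMN]].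
have ex X : exists T, N X -> M T /\ f T = X.
  have [NX|nN] := pselect (N X); last by exists 0.
  by move: NX; rewrite -fMN => -[T MT <-]; exists T.
have [g hg] := choice ex.
have gf T : M T -> g (f T) = T.
  by move=> MT; have [Mg fg] := hg _ (fN _ MT); exact: fI.
have adjP (G : hilbertType R) (X Y : bop G) : adjoint X Y <-> Y = adj X.
  by split=> [/adjointE|->]; [|exact: adj_adjoint].
exists g; split.
  split.
  - by move=> X /hg[].
  - move=> a X Y NX NY; have [MX fX] := hg _ NX; have [MY fY] := hg _ NY.
    by rewrite -{1}fX -{1}fY -fL// gf//; exact: ML.
  - move=> X Y NX NY; have [MX fX] := hg _ NX; have [MY fY] := hg _ NY.
    by rewrite -{1}fX -{1}fY -fM// gf//; exact: MM.
  - move=> X Y NX NY /adjP ->; have [MX fX] := hg _ NX.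
    apply/adjP; have : f (adj (g X)) = adj (f (g X)).
      by apply/adjP/fA; [| exact: MS | exact: adj_adjoint].
    by rewrite fX => <-; rewrite gf//; exact: MS.
  - move=> X Y NX NY e; have [_ <-] := hg _ NX; have [_ <-] := hg _ NY.
    by rewrite e.
have -> : g @` N = M.
  apply/seteqP; split=> [_ [X NX <-]|T MT]; first by case: (hg _ NX).
  by exists (f T); [exact: fN | exact: gf].
exists id; split=> //; split=> //.
by apply/seteqP; split=> [_ [T MT <-]//|T MT]; exists T.
Qed.

(** The projection is f^-1 Q P F, where Q projects M onto f(N) and F is a contractive
    extension of f to B(K). The image f(N) is norm closed, being the set of fixed
    points of Q in M, so that f^-1 is contractive. *)
Lemma tensor_projection P C : 0 <= C ->
  embeds_contractively_complemented N M -> bounded_projection M C P ->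
  exists P', bounded_projection N C P'.
Proof.
move=> C0 [f [[fM fL fC fA fI] [Q [[QL QM Qim QQ] Qn]]]] [PL PM PI Pn].
have [M1 sM clM] := von_neumann_star_algebra hM.
have [N1 sN clN] := vn_tensor_star_algebra ht hM; have [N0 NL NC NS] := sN.
have hf : star_hom N f.
  split=> // S NS'; apply: adjointE.
  by apply: fA => //; [exact: NS | exact: adj_adjoint].
have [F [FL Fn Ff]] := star_hom_extension N1 sN clN hf.
pose A := f @` N.
have QA T : A T -> Q T = T by rewrite /A -Qim => -[S MS <-]; exact: QQ.
have AM T : A T -> M T by exact: QM.
have sA : star_algebra A.
  split.
  - by exists 0 => //; exact: (star_hom0 sN hf).
  - by move=> a _ _ [S NS' <-] [T NT <-]; exists (a *: S + T); [exact: NL | exact: fL].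
  - by move=> _ _ [S NS' <-] [T NT <-]; exists (bop_comp S T); [exact: NC | exact: fC].
  - by move=> _ [S NS' <-]; exists (adj S); [exact: NS | case: hf => _ _ ->].
have clA : norm_closed A.
  move=> T hT.
  have MT : M T by apply: clM => e e0; have [S /AM MS hS] := hT e e0; exists S.
  suff -> : T = Q T by rewrite /A -Qim; exists T.
  apply/eqP; rewrite -subr_eq0; apply/eqP/opnorm0_eq0/ler_addgt0Pr => e e0.
  rewrite add0r; have [S AS hS] := hT (e / 2) (divr_gt0 e0 (ltr0Sn _ _)).
  have -> : T - Q T = - (S - T) + Q (S - T).
    have -> : S - T = (-1) *: T + S by rewrite scaleN1r addrC.
    rewrite QL//; last exact: AM.
    by rewrite (QA S)// !scaleN1r opprD opprK addrACA addNr addr0.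
  rewrite (le_trans (opnormD _ _))// opnormN (splitr e) lerD ?(ltW hS)//.
  rewrite (le_trans (Qn _ _)) ?(ltW hS)//.
  by apply: star_algebraB => //; exact: AM.
have ex T : exists X, A T -> N X /\ f X = T.
  by have [[X NX <-]|nA] := pselect (A T); [exists X | exists 0].
have [g hg] := choice ex.
have gf X : N X -> g (f X) = X.
  move=> NX; have [|Ng fg] := hg (f X); first by exists X.
  exact: fI.
have hgs : star_hom A g.
  split.
  - by move=> a _ _ [S NS' <-] [T NT <-]; rewrite -fL// !gf//; exact: NL.
  - by move=> _ _ [S NS' <-] [T NT <-]; rewrite -fC// !gf//; exact: NC.
  - move=> _ [S NS' <-]; have [_ _ fS] := hf.
    by rewrite -fS// !gf//; exact: NS.
have gn T : A T -> opnorm (g T) <= opnorm T.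
  apply: (star_hom_contractive sA clA hgs (e := f (bop_id K))).
  - by exists (bop_id K).
  - by have [_ _ <-//] := hf; rewrite adj_id.
  - by move=> _ [S NS' <-]; rewrite -fC// bop_comp1l.
  - by move=> _ [S NS' <-]; rewrite -fC// bop_comp1r.
have AQ T : M T -> A (Q T) by move=> MT; rewrite /A -Qim; exists T.
exists (fun X => g (Q (P (F X)))); split.
- move=> a X Y; rewrite FL PL QL//; case: hgs => gL _ _; apply: gL; exact: AQ.
- by move=> X; case: (hg _ (AQ _ (PM (F X)))).
- move=> X NX; rewrite Ff// PI; last exact: fM.
  by rewrite QA ?gf//; exists X.
- move=> X; rewrite (le_trans (gn _ (AQ _ (PM _))))// (le_trans (Qn _ (PM _)))//.
  by rewrite (le_trans (Pn _))// ler_wpM2l.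
Qed.

Lemma opnormZ_inv (z : R[i]) (r : R) (T : bop H) : 0 < r -> r <= complex.Re z ->
  opnorm (z^-1 *: T) <= r^-1 * opnorm T.
Proof.
move=> r0 rz; apply: opnorm_le => [|x]; first by rewrite mulr_ge0 ?opnorm_ge0 ?invr_ge0 ?ltW.
have z0 : z != 0 by apply: contraTneq rz => ->; rewrite -ltNge /=.
rewrite bopZE -mulrA ler_pdivlMl// (le_trans _ (nrm_opnorm T x))//.
have -> : nrm (T x) = complex.Re `|z| * nrm (z^-1 *: T x).
  by rewrite -nrmZ scalerA mulfV// scale1r.
rewrite ler_wpM2r ?nrm_ge0// (le_trans rz)// (le_trans (ler_norm _))//.
by have := normc_ge_Re z; rewrite lecE => /andP[_].
Qed.

(** For s the sum of the a_i (x) <. x_i, y_i>, consider the sum Gv T of the slices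
    of P' (T (x) a_i) by x_i and y_i. On M it is multiplication by the complex
    trace of s, the real part of which is tau. Slicing P' (T (x) S) by u and v on
    the other factor gives a multiple, by at most C |T| |u| |v|, of a contraction
    applied to S, and Re <Gv T u, v> is the value of s at this multiple; hence the
    norm of Gv is at most k C. *)
Lemma sliced_projection P' C s k : 0 <= C -> bounded_projection N C P' ->
  (forall q, q \in s -> M q.1.1) ->
  (forall G, contractions M G -> trace_form s G <= k) -> 0 <= k -> k < trace_form s id ->
  exists P, bounded_projection M (C * (k / trace_form s id)) P.
Proof.
move=> C0 [PL PN PI Pn] Ms hk k0 ktau.
have [M1 sM clM] := von_neumann_star_algebra hM.
set tau := trace_form s id in ktau *.
have tau0 : 0 < tau by exact: le_lt_trans ktau.
pose Gv T := \sum_(q <- s) slice tm q.1.2 q.2 (P' (tensor ht T q.1.1)).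
pose z : R[i] := \sum_(q <- s) inner (q.1.1 q.1.2) q.2.
have Rez : complex.Re z = tau.
  rewrite /z /tau /trace_form; apply: (big_morph (fun z : R[i] => complex.Re z)) => // x y.
  exact: ReD.
have GvL : linear_map Gv.
  move=> a T S; rewrite /Gv scaler_sumr -big_split; apply: eq_bigr => q _ /=.
  by rewrite tensorLl PL sliceL.
have GvM T : M (Gv T).
  by apply: star_algebra_sum => // q _; exact: (slice_vn_tensor ht hM _ _ (PN _)).
have GvI T : M T -> Gv T = z *: T.
  move=> MT; rewrite /Gv /z scaler_suml; apply: eq_big_seq => q qs.
  rewrite PI; last by apply: vn_tensor_tensor => //; exact: Ms.
  exact: (slice_tensor tm _ _ (tensorE ht T q.1.1)).
have Gvn T : opnorm (Gv T) <= k * (C * opnorm T).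
  have T0 := opnorm_ge0 T.
  apply: opnorm_le => [|u]; first by rewrite !mulr_ge0.
  apply: nrm_le_ri => [|v]; first by rewrite !mulr_ge0 ?nrm_ge0.
  pose G' S := slice (tensor_map_flip tm) u v (P' (tensor ht T S)).
  pose kap := C * opnorm T * (nrm u * nrm v).
  have kap0 : 0 <= kap by rewrite !mulr_ge0 ?nrm_ge0.
  have -> : ri (Gv T u) v = trace_form s G'.
    rewrite /Gv bop_sumE ri_suml; apply: eq_bigr => q _.
    by rewrite /G' !sliceE.
  have G'n S : opnorm (G' S) <= kap * opnorm S.
    rewrite (le_trans (slice_bound _ _ _ _))// /kap mulrAC ler_wpM2r ?mulr_ge0 ?nrm_ge0//.
    by rewrite (le_trans (Pn _))// -mulrA ler_wpM2l// tensor_bound.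
  have G'L : linear_map G' by move=> a S S'; rewrite /G' tensorLr PL sliceL.
  have -> : k * (C * opnorm T) * nrm u * nrm v = k * kap by rewrite /kap; ring.
  have := kap0; rewrite le_eqVlt => /orP[/eqP k00|kap1].
    rewrite -k00 mulr0 /trace_form big1// => q _.
    rewrite (@opnorm0_eq0 _ _ (G' q.1.1)) ?bop0E ?ri0l//.
    by rewrite (le_trans (G'n _))// -k00 mul0r.
  have kap1' : 0 <= kap^-1 by rewrite invr_ge0.
  have := hk (fun S => (kap^-1)%:C *: G' S).
  have -> : trace_form s (fun S => (kap^-1)%:C *: G' S) = kap^-1 * trace_form s G'.
    by rewrite /trace_form mulr_sumr; apply: eq_bigr => q _; rewrite bopZE riZl.
  rewrite ler_pdivrMl// mulrC; apply; split.
  - by move=> a S S'; rewrite G'L scalerDr !scalerA mulrC.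
  - by move=> S; apply: star_algebraZ => //; exact: (slice_flip_vn_tensor ht hM _ _ (PN _)).
  - move=> S; rewrite (le_trans (opnormZr _ _))// ger0_norm//.
    by rewrite ler_pdivrMl.
have z0 : z != 0 by apply: contraTneq tau0 => z0; rewrite -Rez z0 /= ltxx.
exists (fun T => z^-1 *: Gv T); split.
- by move=> a T S; rewrite GvL scalerDr !scalerA mulrC.
- by move=> T; apply: star_algebraZ.
- by move=> T MT; rewrite GvI// scalerA mulVf// scale1r.
- move=> T; rewrite (le_trans (@opnormZ_inv z tau _ tau0 _)) ?Rez//.
  rewrite (le_trans (ler_wpM2l _ (Gvn T))) ?invr_ge0 ?(ltW tau0)//.
  by rewrite le_eqVlt; apply/orP; left; apply/eqP; ring.
Qed.

(** If some tensor has trace larger than its norm, every projection can be improved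
    by the same factor less than 1. *)
Lemma trace_bounded_or_contractive P C : 0 <= C ->
  embeds_contractively_complemented N M -> bounded_projection M C P ->
  trace_bounded M \/ exists P, bounded_projection M 1 P.
Proof.
move=> C0 emb hP; have [|ntb] := pselect (trace_bounded M); [by left | right].
have [M1 sM clM] := von_neumann_star_algebra hM.
move: ntb => /existsNP[s /existsNP[k /not_implyP[Ms /not_implyP[hk /negP]]]].
rewrite -ltNge => ktau.
have k0 : 0 <= k.
  have := hk (fun _ => 0); rewrite /trace_form big1; last by move=> q _; rewrite bop0E ri0l.
  apply; split=> [a T S|T|T]; first by rewrite scaler0 addr0.
    by case: sM.
  by rewrite opnorm_0 opnorm_ge0.
set tau := trace_form s id in ktau; pose rho := k / tau.
have tau0 : 0 < tau by exact: le_lt_trans ktau.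
have rho01 : 0 <= rho < 1 by rewrite divr_ge0 ?(ltW tau0)//= ltr_pdivrMr// mul1r.
have iterate n : exists P, bounded_projection M (C * rho ^+ n) P.
  elim: n => [|n [Q hQ]]; first by exists P; rewrite expr0 mulr1.
  have Cn0 : 0 <= C * rho ^+ n by rewrite mulr_ge0 ?exprn_ge0//; case/andP: rho01.
  have [P' hP'] := tensor_projection Cn0 emb hQ.
  rewrite exprSr mulrA; exact: (sliced_projection Cn0 hP' Ms hk k0 ktau).
have C1 : 0 < C + 1 by rewrite ltr_wpDl.
have [n hn] := exp_small rho01 (divr_gt0 ltr01 C1).
have [Q [QL QM QI Qn]] := iterate n; exists Q; split=> // T.
rewrite (le_trans (Qn T))// ler_wpM2r ?opnorm_ge0//.
move: hn; rewrite ltr_pdivlMr// => hn; have := exprn_ge0 n (proj1 (andP rho01)).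
nra.
Qed.

End TensorProjection.

Theorem mainTheorem1 (R : realType) (H : hilbertType R) (M : set (bop H))
    (K : hilbertType R) (t : {bilinear H -> H -> K}) :
  von_neumann_algebra M ->
  hilbert_tensor t ->
  vn_isomorphic M (vn_tensor t M M) \/
    embeds_contractively_complemented (vn_tensor t M M) M ->
  complemented M setT ->
  contractively_complemented M setT.
Proof.
move=> hM ht hemb [P [hP [C hC]]].
have emb : embeds_contractively_complemented (vn_tensor t M M) M.
  by case: hemb => // /(vn_isomorphic_embeds ht hM).
have hP' : bounded_projection M `|C| P.
  apply: linear_projection_bounded hP _ => T.
  by rewrite (le_trans (hC T I))// ler_wpM2r ?opnorm_ge0 ?ler_norm.
apply: contractively_complementedP.
have [tb|//] := trace_bounded_or_contractive ht hM (normr_ge0 C) emb hP'.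
exact: mean_projection.
Qed.
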